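(* Let $S$ be a standard graded algebra over a commutative ring $R$, generated as an $R$-algebra by $n$ elements $X_1,\dots,X_n$ of degree one. Let $M$ be a finitely generated graded $S$-module and $I$ a finitely generated ideal of $R$. Then: (a) $\operatorname{cd}_I(M_\mu)$ is a non decreasing function of $\mu$ for $\mu>a^0_{S_+}(M)$; (b) $\operatorname{cd}_I(M_\mu)$ is constant for $\mu\geq\operatorname{reg}(M)+n-\operatorname{depth}_{S_+}(M)$, if $n>0$.
   Context: No Noetherian hypothesis is made. $S=\bigoplus_{\mu\ge0}S_\mu$ with $S_0=R$, and $S_+=\bigoplus_{\mu>0}S_\mu=(X_1,\dots,X_n)$. Graded modules are $\mathbf{Z}$-graded; $M_\mu$ is the degree $\mu$ component (an $R$-module). For a commutative ring $A$, a finitely generated ideal $I=(a_1,\dots,a_r)$ and an $A$-module $N$, $H^i_I(N)$ denotes the $i$-th cohomology module of the Čech complex of $N$ on $a_1,\dots,a_r$. One sets $\operatorname{depth}_I(N):=\max\{p\in\mathbf{N}\cup\{+\infty\}\mid H^i_I(N)=0\ \forall i<p\}$ and $\operatorname{cd}_I(N):=\max\{p\in\mathbf{N}\mid H^p_I(N)\neq0\}$, with $\operatorname{cd}_I(N)=-\infty$ if all $H^p_I(N)$ vanish. For a graded $S$-module $M$: $a^i_{S_+}(M):=\sup\{\mu\mid H^i_{S_+}(M)_\mu\neq0\}$ and $\operatorname{reg}(M):=\sup\{\mu\mid\exists i,\ H^i_{S_+}(M)_{\mu-i}\neq0\}=\max_i\{a^i_{S_+}(M)+i\}$, with $\sup\emptyset=-\infty$.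 If $\operatorname{depth}_{S_+}(M)=+\infty$ then $\operatorname{reg}(M)=-\infty$ and the bound in (b) is $-\infty$. *)

(* Defs.v *)
From HB Require Import structures.
From mathcomp Require Import all_boot all_order all_algebra.
From mathcomp Require Import generic_quotient.
From mathcomp Require Import boolp classical_sets constructive_ereal.
From mathcomp Require Import zify.

Set Implicit Arguments.
Unset Strict Implicit.
Unset Printing Implicit Defensive.

Import Order.TTheory GRing.Theory Num.Theory.

Local Open Scope ring_scope.
Local Open Scope quotient_scope.

(* The localization N_a of an A-module N at a single element a : A. The pair
   (x, k) stands for the fraction x / a ^+ k. *)
Section Localization.
Variables (A : comPzRingType) (N : lmodType A) (a : A).

Definition frac_eq (u v : N * nat) : bool :=
  `[< exists l, a ^+ (l + v.2) *: u.1 = a ^+ (l + u.2) *: v.1 >].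

Lemma frac_eq_refl : reflexive frac_eq.
Proof. by move=> u; apply/asboolP; exists 0%N. Qed.

Lemma frac_eq_sym : symmetric frac_eq.
Proof. by move=> u v; apply/asboolP/asboolP => -[l h]; exists l. Qed.

Lemma frac_eq_trans : transitive frac_eq.
Proof.
move=> [y j] [x i] [z k] /asboolP[l /= h1] /asboolP[m /= h2].
apply/asboolP; exists (l + m + j)%N => /=.
have -> : (l + m + j + k = m + k + (l + j))%N by lia.
rewrite exprD -scalerA h1 scalerA mulrC -scalerA h2 scalerA -exprD.
congr (_ ^+ _ *: _); lia.
Qed.

Canonical frac_equiv := EquivRel frac_eq frac_eq_refl frac_eq_sym frac_eq_trans.

Definition localization := {eq_quot frac_equiv}.
HB.instance Definition _ : EqQuotient _ frac_equiv localization :=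
  EqQuotient.on localization.
HB.instance Definition _ := Choice.on localization.

Definition frac (x : N) (k : nat) : localization := \pi_localization (x, k).

Lemma fracP x i y j :
  (exists l, a ^+ (l + j) *: x = a ^+ (l + i) *: y) <-> frac x i = frac y j.
Proof. by split => [h|/eqmodP/asboolP//]; apply/eqmodP/asboolP. Qed.

Lemma fracE (q : localization) : exists x k, q = frac x k.
Proof. by exists (repr q).1, (repr q).2; rewrite /frac -surjective_pairing reprK. Qed.

Lemma frac_expand l x k : frac (a ^+ l *: x) (l + k) = frac x k.
Proof. by apply/fracP; exists 0%N; rewrite !add0n scalerA -exprD addnC. Qed.

Definition loc_zero : localization := frac 0 0.
Definition loc_opp (q : localization) : localization :=
  let u := repr q in frac (- u.1) u.2.
Definition loc_add (q r : localization) : localization :=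
  let u := repr q in let v := repr r in
  frac (a ^+ v.2 *: u.1 + a ^+ u.2 *: v.1) (u.2 + v.2).
Definition loc_scale (c : A) (q : localization) : localization :=
  let u := repr q in frac (c *: u.1) u.2.

Lemma repr_frac x k :
  exists l, a ^+ (l + k) *: (repr (frac x k)).1
          = a ^+ (l + (repr (frac x k)).2) *: x.
Proof. by apply/fracP; rewrite /frac -surjective_pairing reprK. Qed.

Lemma loc_oppE x k : loc_opp (frac x k) = frac (- x) k.
Proof.
have [l h] := repr_frac x k; apply/fracP; exists l.
by rewrite !scalerN h.
Qed.

Lemma loc_scaleE c x k : loc_scale c (frac x k) = frac (c *: x) k.
Proof.
have [l h] := repr_frac x k; apply/fracP; exists l.
by rewrite !scalerA ![_ * c]mulrC -!scalerA h.
Qed.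

Lemma loc_addE x i y j :
  loc_add (frac x i) (frac y j) = frac (a ^+ j *: x + a ^+ i *: y) (i + j).
Proof.
rewrite /loc_add; have [l] := repr_frac x i; have [m] := repr_frac y j.
case: (repr (frac x i)) => x' i' /=; case: (repr (frac y j)) => y' j' /= hy hx.
apply/fracP; exists (l + m)%N; rewrite !scalerDr !scalerA -!exprD.
congr (_ + _).
  have -> : (l + m + (i + j) + j' = (m + j + j') + (l + i))%N by lia.
  rewrite exprD -scalerA hx scalerA -exprD; congr (_ ^+ _ *: _); lia.
have -> : (l + m + (i + j) + i' = (l + i + i') + (m + j))%N by lia.
rewrite exprD -scalerA hy scalerA -exprD; congr (_ ^+ _ *: _); lia.
Qed.

Lemma loc_addC : commutative loc_add.
Proof.
move=> q r; have [x [i ->]] := fracE q; have [y [j ->]] := fracE r.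
by rewrite !loc_addE addrC addnC.
Qed.

Lemma loc_addA : associative loc_add.
Proof.
move=> q r s; have [x [i ->]] := fracE q; have [y [j ->]] := fracE r.
have [z [k ->]] := fracE s; rewrite !loc_addE addnA; congr frac.
by rewrite !scalerDr !scalerA -!exprD addrA (addnC k) (addnC k).
Qed.

Lemma loc_add0 : left_id loc_zero loc_add.
Proof.
by move=> q; have [x [i ->]] := fracE q; rewrite loc_addE scaler0 add0r scale1r.
Qed.

Lemma frac0 k : frac 0 k = loc_zero.
Proof. by apply/fracP; exists 0%N; rewrite !scaler0. Qed.

Lemma loc_addN : left_inverse loc_zero loc_opp loc_add.
Proof.
move=> q; have [x [i ->]] := fracE q.
by rewrite loc_oppE loc_addE scalerN addNr frac0.
Qed.

HB.instance Definition _ :=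
  GRing.isZmodule.Build localization loc_addA loc_addC loc_add0 loc_addN.

Lemma loc_scaleA c d q : loc_scale c (loc_scale d q) = loc_scale (c * d) q.
Proof. by have [x [i ->]] := fracE q; rewrite !loc_scaleE scalerA. Qed.

Lemma loc_scale1 : left_id 1 loc_scale.
Proof. by move=> q; have [x [i ->]] := fracE q; rewrite loc_scaleE scale1r. Qed.

Lemma loc_scaleDr : right_distributive loc_scale +%R.
Proof.
move=> c q r; have [x [i ->]] := fracE q; have [y [j ->]] := fracE r.
rewrite /GRing.add /= !(loc_addE, loc_scaleE); congr frac.
by rewrite scalerDr !scalerA !(mulrC c).
Qed.

Lemma loc_scaleDl q : {morph loc_scale^~ q : c d / c + d}.
Proof.
move=> c d; have [x [i ->]] := fracE q.
rewrite [RHS]/GRing.add /= !loc_scaleE loc_addE -scalerDr -scalerDl.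
by rewrite frac_expand.
Qed.

HB.instance Definition _ := GRing.Zmodule_isLmodule.Build A localization
  loc_scaleA loc_scale1 loc_scaleDr loc_scaleDl.

End Localization.

Arguments frac {A N} a x k.

(* The Cech complex of N on a family a_0, ..., a_(r-1) is
     C^p = \bigoplus_(#|s| = p) N_(a_s),  a_s = \prod_(i in s) a_i,
   s ranging over the subsets of 'I_r. A cochain is represented by its whole
   family of coordinates (c s)_s, those of degree p being supported on the
   subsets s with p elements. *)
Section Cech.
Variables (A : comPzRingType) (r : nat) (a : 'I_r -> A) (N : lmodType A).

Definition cech_den (s : {set 'I_r}) : A := \prod_(i in s) a i.

Definition cochain := forall s : {set 'I_r}, localization N (cech_den s).

(* For i \in t this is the localization map N_(a_(t \ i)) -> N_(a_t),
   x / a_(t \ i) ^+ k |-> (a_i ^+ k *: x) / a_t ^+ k (see [cech_resE]). *)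
Definition cech_res (t : {set 'I_r}) (i : 'I_r)
    (q : localization N (cech_den (t :\ i))) : localization N (cech_den t) :=
  let u := repr q in frac (cech_den t) (a i ^+ u.2 *: u.1) u.2.

Lemma cech_resE (t : {set 'I_r}) (i : 'I_r) x k : i \in t ->
  @cech_res t i (frac (cech_den (t :\ i)) x k)
  = frac (cech_den t) (a i ^+ k *: x) k.
Proof.
move=> it; have dt : cech_den t = a i * cech_den (t :\ i).
  by rewrite /cech_den (big_setD1 _ it).
rewrite /cech_res; have [l] := repr_frac (cech_den (t :\ i)) x k.
case: (repr _) => x' k' /= h; apply/fracP; exists l.
rewrite dt !exprMn !scalerA [_ * a i ^+ k']mulrAC -(scalerA _ _ x') h scalerA.
by rewrite -exprD [in RHS]mulrAC -exprD addnAC.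
Qed.

Definition cech_d (c : cochain) : cochain := fun t =>
  \sum_(i in t) (-1) ^+ #|[set j in t | (j < i)%N]| *: cech_res (c (t :\ i)).

Definition cocycle (p : nat) (c : cochain) : Prop :=
  (forall s : {set 'I_r}, #|s| != p -> c s = 0) /\ (forall t, cech_d c t = 0).

Definition coboundary (p : nat) (c : cochain) : Prop :=
  exists b : cochain,
    (forall s : {set 'I_r}, #|s|.+1 != p -> b s = 0) /\ (forall t, c t = cech_d b t).

(* H^p = 0, where H^p is the quotient of p-cocycles by p-coboundaries *)
Definition cohom_eq0 (p : nat) : Prop :=
  forall c, cocycle p c -> coboundary p c.

End Cech.

Arguments cohom_eq0 {A r} a N p.

(* Suprema in Z \cup {-oo, +oo}: sup set0 = -oo, and a maximum is a supremum. *)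
Definition esup (E : set (\bar int)) : \bar int := supremum -oo%E E.

Lemma esupP (E : set (\bar int)) : supremums E (esup E).
Proof.
suff ex : exists x, supremums E x.
  rewrite /esup /supremum; case: ifPn => [/eqP ->|_]; last first.
    by case: ex => x Ex; apply: (xgetPex _ (ex_intro _ x Ex)).
  by split => [y []|y _]; exact: leNye.
have [[m ubm]|nub] := pselect (exists m : int, ubound E m%:E); last first.
  exists +oo%E; split => [y _|y uby]; first exact: leey.
  case: y uby => [m ubm| //|ubN]; first by case: nub; exists m.
  by case: nub; exists 0; move=> y /ubN yN; apply: le_trans yN _; exact: leNye.
have [[k Ek]|nE] := pselect (exists k : int, E k%:E); last first.
  exists -oo%E; split => [y Ey|y _]; last exact: leNye.
  by case: y Ey => [y Ey|/ubm|//] //; case: nE; exists y.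
pose P i := `[< E (m - i%:Z)%:E >].
have inP j : E j%:E -> P `|m - j|%N /\ j <= m.
  move=> Ej; have := ubm _ Ej; rewrite lee_fin => jm; split=> //.
  by apply/asboolP; rewrite gez0_abs ?subr_ge0// subKr.
have exP : exists i, P i by exists `|m - k|%N; case: (inP _ Ek).
case: (ex_minnP exP) => i /asboolP Ei mini.
exists (m - i%:Z)%:E; split => [y Ey|y uby]; last exact: uby.
case: y Ey => [j /inP[/mini ij jm]|/ubm//|_]; last exact: leNye.
by rewrite lee_fin; lia.
Qed.

(* depth_I and cd_I of the ideal I generated by the family a; the maximum
   defining depth_I ranges over p in N \cup {+oo}. *)
Definition depth (A : comPzRingType) (r : nat) (a : 'I_r -> A) (N : lmodType A)
    : \bar int :=
  esup [set p : \bar int |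
         (0%:E <= p)%E /\ forall i : nat, (i%:Z%:E < p)%E -> cohom_eq0 a N i].

Definition cd (A : comPzRingType) (r : nat) (a : 'I_r -> A) (N : lmodType A)
    : \bar int :=
  esup [set p%:Z%:E | p in [set p : nat | ~ cohom_eq0 a N p]].

Definition res_scalars (R S : comPzRingType) (f : {rmorphism R -> S})
    (M : lmodType S) : Type := M.

Section ResScalars.
Variables (R S : comPzRingType) (f : {rmorphism R -> S}) (M : lmodType S).

Local Notation res_scalars := (res_scalars f M).
HB.instance Definition _ := GRing.Zmodule.on res_scalars.

Definition res_scale (c : R) (x : res_scalars) : res_scalars :=
  f c *: (x : M).

Lemma res_scaleA c d x : res_scale c (res_scale d x) = res_scale (c * d) x.
Proof. by rewrite /res_scale scalerA rmorphM. Qed.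
Lemma res_scale1 : left_id 1 res_scale.
Proof. by move=> x; rewrite /res_scale rmorph1 scale1r. Qed.
Lemma res_scaleDr : right_distributive res_scale +%R.
Proof. by move=> c x y; rewrite /res_scale scalerDr. Qed.
Lemma res_scaleDl x : {morph res_scale^~ x : c d / c + d}.
Proof. by move=> c d; rewrite /res_scale rmorphD scalerDl. Qed.

HB.instance Definition _ := GRing.Zmodule_isLmodule.Build R res_scalars
  res_scaleA res_scale1 res_scaleDr res_scaleDl.

End ResScalars.

Section Submodule.
Variables (R : pzRingType) (V : lmodType R) (P : submodClosed V).

Record submodule := Submodule { submod_val : V; _ : submod_val \in P }.
HB.instance Definition _ := [isSub for submod_val].
HB.instance Definition _ := [Choice of submodule by <:].
HB.instance Definition _ := [SubChoice_isSubLmodule of submodule by <:].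

End Submodule.

Definition is_direct_sum (I : eqType) (V : zmodType) (D : I -> {pred V}) : Prop :=
  (forall x, exists (s : seq I) (c : I -> V),
     [/\ uniq s, forall i, c i \in D i & x = \sum_(i <- s) c i])
  /\ (forall (s : seq I) (c : I -> V), uniq s -> (forall i, c i \in D i) ->
        \sum_(i <- s) c i = 0 -> forall i, i \in s -> c i = 0).

(* The R-algebra S, with structure morphism f, is graded by (S_ i)_i with
   S_ 0 = R, and is generated over R by the X_i, which have degree one. *)
Record standard_graded (R S : comPzRingType) (f : {rmorphism R -> S})
    (S_ : nat -> zmodClosed S) (n : nat) (X : 'I_n -> S) : Prop := {
  sg_sum : is_direct_sum (fun i => [pred x | x \in S_ i]);
  sg_mul : forall i j x y, x \in S_ i -> y \in S_ j -> x * y \in S_ (i + j)%N;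
  sg_inj : injective f;
  sg_zero : forall x, x \in S_ 0%N <-> exists c, x = f c;
  sg_deg1 : forall i, X i \in S_ 1%N;
  sg_gen : forall P : S -> Prop,
    (forall c, P (f c)) -> (forall i, P (X i)) ->
    (forall x y, P x -> P y -> P (x + y)) ->
    (forall x y, P x -> P y -> P (x * y)) -> forall x, P x }.

Record graded_module (R S : comPzRingType) (f : {rmorphism R -> S})
    (S_ : nat -> zmodClosed S) (M : lmodType S)
    (M_ : int -> submodClosed (res_scalars f M)) : Prop := {
  gm_sum : is_direct_sum (fun mu => [pred x : M | x \in M_ mu]);
  gm_scale : forall (i : nat) (mu : int) (s : S) (x : M),
    s \in S_ i -> x \in M_ mu -> s *: x \in M_ (i%:Z + mu) }.

Definition finitely_generated (A : comPzRingType) (N : lmodType A) : Prop :=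
  exists (k : nat) (g : 'I_k -> N),
    forall x, exists c : 'I_k -> A, x = \sum_i c i *: g i.

Section GradedCohomology.
Variables (R S : comPzRingType) (f : {rmorphism R -> S}) (n : nat).
Variables (X : 'I_n -> S) (M : lmodType S).
Variable (M_ : int -> submodClosed (res_scalars f M)).

(* The degree mu part of the Cech complex on the X_i, which have degree one,
   so that X_s has degree #|s|. *)
Definition homogeneous (mu : int) (c : cochain X M) : Prop :=
  forall s : {set 'I_n}, exists (x : M) (k : nat),
    x \in M_ (mu + (k * #|s|)%:Z) /\ c s = frac (cech_den X s) x k.

(* H^p_(mu) = 0: the degree mu component of H^p consists of the classes of the
   homogeneous cocycles of degree mu. *)
Definition gr_cohom_eq0 (p : nat) (mu : int) : Prop :=
  forall c : cochain X M, homogeneous mu c -> cocycle p c -> coboundary p c.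

Definition a_inv (i : nat) : \bar int :=
  esup [set mu%:E | mu in [set mu : int | ~ gr_cohom_eq0 i mu]].

Definition reg : \bar int :=
  esup [set mu%:E | mu in
    [set mu : int | exists i : nat, ~ gr_cohom_eq0 i (mu - i%:Z)]].

End GradedCohomology.

(* Main.v *)
Require Import Defs.
From HB Require Import structures.
From mathcomp Require Import all_boot all_order all_algebra.
From mathcomp Require Import generic_quotient.
From mathcomp Require Import boolp classical_sets constructive_ereal.
From mathcomp Require Import zify.

Set Implicit Arguments.
Unset Strict Implicit.
Unset Printing Implicit Defensive.

Import Order.TTheory GRing.Theory Num.Theory.

Local Open Scope ring_scope.

Local Notation frac := Defs.frac.

(** The proof compares annihilators. Over a commutative ring A, let P be a
    finitely generated module and N a module killed by ann P. Then every
    vanishing H^i_I(P) = 0 for all i >= t passes to N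
    ([cohom_eq0_annihilator]), so cd_I(N) <= cd_I(P) ([cd_le_annihilator]).
    Indeed, by descending induction on i one may
    assume that H^(i+1) vanishes on all modules killed by ann P; then H^i is
    right exact on these modules, and the class of those on which it vanishes is
    closed under extensions, finite sums, quotients, and unions of images of
    members. It remains to reach N from P ([good_by_annihilator]), by induction
    on the number of generators e_1, ..., e_m of P. If ann(e_j) kills N and b
    carries P into A e_j, then for y in N multiplication by b followed by
    e_j |-> y is a map P -> N which reaches b y; thus b y lies in the part of N
    covered by good modules, and what is left of N is killed by ann(P / A e_j),
    where the induction hypothesis applies. Passing from ann(e_j) to their
    intersection ann P costs only extensions, because the product of the
    ann(e_j) lies in the intersection.

    The components M_mu are finitely generated R-modules
    ([graded_component_fg]), and two facts compare their annihilators.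
    - For mu > a^0(M), no nonzero element of M_mu is killed by all the X_i; if c
      kills M_(mu+1) then X_i (c x) = 0 for x in M_mu, so c kills M_mu
      ([ann_below]). This is the monotonicity in (a).
    - For nu > reg(M), M_nu is the sum of the X_i M_(nu-1), so that ann M_(nu-1)
      kills M_nu ([generated_below], [ann_above]); this is the reverse
      inequality which (b) needs.
    The generation in degrees at most reg(M) comes from the double complex of
    Koszul chains with values in the Cech complex ([chase]). Its columns over
    M_(X_s), s nonempty, are exact since some X_i is invertible there, and in
    total degree zero its rows have the cohomology H^p_(nu-p), which vanishes for
    nu > reg(M). A Koszul-degree zero element of M_nu is therefore a Koszul
    boundary. Here the primitives have to be homogeneous, which is arranged by
    projecting the localizations onto their homogeneous parts ([loc_pr]).

    Finally an integer mu >= reg(M) + n - depth(M) satisfies mu >= reg(M) and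
    mu > a^0(M), as depth(M) is at most n unless all cohomology vanishes, and a
    positive depth makes a^0(M) equal to -oo ([regularity_bound]). *)

(** * Fractions and localized linear maps *)

Lemma linear_fun (A : pzRingType) (V W : lmodType A) (g : V -> W) :
  linear g -> exists h : {linear V -> W}, h =1 g.
Proof.
move=> lg.
pose h : {linear V -> W} := HB.pack g (GRing.isLinear.Build A V W *:%R g lg).
by exists h.
Qed.

Section Fractions.
Variables (A : comPzRingType) (N : lmodType A) (a : A).
Implicit Types (x y : N) (q : localization N a).

Lemma fracD x y k : frac a x k + frac a y k = frac a (x + y) k.
Proof. by rewrite [LHS]/GRing.add /= loc_addE -scalerDr frac_expand. Qed.

Lemma fracZ c x k : c *: frac a x k = frac a (c *: x) k.
Proof. by rewrite [LHS]/GRing.scale /= loc_scaleE. Qed.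

Lemma frac_eq0 x k : frac a x k = 0 <-> exists l, a ^+ l *: x = 0.
Proof.
rewrite -[0](frac0 N a 0) -fracP; split=> -[l h]; exists l.
  by move: h; rewrite addn0 scaler0.
by rewrite addn0 h scaler0.
Qed.

Lemma frac_common q1 q2 : exists x y k, q1 = frac a x k /\ q2 = frac a y k.
Proof.
have [x [i ->]] := fracE q1; have [y [j ->]] := fracE q2.
exists (a ^+ j *: x), (a ^+ i *: y), (j + i)%N.
by rewrite frac_expand addnC frac_expand.
Qed.

End Fractions.

Section LocalizationMap.
Variables (A : comPzRingType) (N N' : lmodType A) (h : {linear N -> N'}) (a : A).

Definition loc_map (q : localization N a) : localization N' a :=
  frac a (h (repr q).1) (repr q).2.

Lemma loc_mapE x k : loc_map (frac a x k) = frac a (h x) k.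
Proof.
have [l e] := repr_frac a x k; apply/fracP; exists l.
by rewrite -!linearZ e.
Qed.

Lemma loc_map_linear : linear loc_map.
Proof.
move=> c q1 q2; have [x [y [k [-> ->]]]] := frac_common q1 q2.
by rewrite fracZ fracD !loc_mapE fracZ fracD linearP.
Qed.

HB.instance Definition _ :=
  GRing.isLinear.Build A (localization N a) (localization N' a) *:%R loc_map
    loc_map_linear.

Lemma loc_map_surj : (forall y, exists x, h x = y) ->
  forall q, exists p, loc_map p = q.
Proof.
move=> sh q; have [y [k ->]] := fracE q; have [x <-] := sh y.
by exists (frac a x k); rewrite loc_mapE.
Qed.

Lemma loc_map_inj : injective h -> injective loc_map.
Proof.
move=> ih q1 q2; have [x [y [k [-> ->]]]] := frac_common q1 q2.
rewrite !loc_mapE -fracP => -[l e]; apply/fracP; exists l.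
by apply: ih; rewrite !linearZ.
Qed.

End LocalizationMap.

Lemma loc_map_comp0 (A : comPzRingType) (N1 N2 N3 : lmodType A)
    (g : {linear N1 -> N2}) (h : {linear N2 -> N3}) (a : A) q :
  (forall x, h (g x) = 0) -> loc_map h (@loc_map _ _ _ g a q) = 0.
Proof.
move=> hg; have [x [k ->]] := fracE q.
by rewrite !loc_mapE hg frac0.
Qed.

(** Localization is exact: a fraction killed by [h] becomes, once its numerator
    is multiplied by a power of [a], a fraction with numerator in the kernel. *)
Lemma loc_map_exact (A : comPzRingType) (N1 N2 N3 : lmodType A)
    (g : {linear N1 -> N2}) (h : {linear N2 -> N3}) (a : A) q :
  (forall y, h y = 0 -> exists x, g x = y) ->
  @loc_map _ _ _ h a q = 0 -> exists p, loc_map g p = q.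
Proof.
move=> ex; have [y [k ->]] := fracE q.
rewrite loc_mapE => /frac_eq0[l]; rewrite -linearZ => /ex[x e].
by exists (frac a x (l + k)); rewrite loc_mapE e frac_expand.
Qed.

(** * The Cech differential squares to zero *)

(** The same sign serves the Cech differential, where i is in T, and the Koszul
    differential, where i is not. *)
Definition pos_sign (A : pzRingType) (r : nat) (i : 'I_r) (T : {set 'I_r}) : A :=
  (-1) ^+ #|[set j in T | (j < i)%N]|.
Arguments pos_sign {A r}.

Section Signs.
Variables (A : pzRingType) (r : nat).
Implicit Types (i j : 'I_r) (T : {set 'I_r}).

Lemma pos_signD1 i T : pos_sign i (T :\ i) = pos_sign i T :> A.
Proof.
rewrite /pos_sign; congr (_ ^+ _); apply: eq_card => j.
by rewrite !inE; case: eqP => [->|] //=; rewrite ltnn andbF.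
Qed.

Lemma pos_signU1 i T : pos_sign i (i |: T) = pos_sign i T :> A.
Proof.
rewrite /pos_sign; congr (_ ^+ _); apply: eq_card => j.
by rewrite !inE; case: eqP => [->|] //=; rewrite ltnn andbF.
Qed.

Lemma pos_sign_add i j T : j \notin T ->
  pos_sign i (j |: T) = (if (j < i)%N then -1 else 1) * pos_sign i T :> A.
Proof.
move=> jT; rewrite /pos_sign; case: ifP => ji.
  rewrite -exprS; congr (_ ^+ _).
  rewrite (cardsD1 j) !inE eqxx ji /=; congr (_.+1).
  apply: eq_card => k; rewrite !inE; case: eqP => [->|] //=.
  by rewrite (negbTE jT).
rewrite mul1r; congr (_ ^+ _); apply: eq_card => k; rewrite !inE.
by case: eqP => [->|] //=; rewrite ji (negbTE jT).
Qed.

Lemma pos_sign2 i T : pos_sign i T * pos_sign i T = 1 :> A.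
Proof. by rewrite /pos_sign -exprD addnn -signr_odd odd_double. Qed.

(** Each of i and j is inserted once with and once without the other; the smaller
    one changes the parity for the larger one, and not conversely. This is why
    the Cech and the Koszul differentials square to zero. *)
Lemma pos_sign_swap i j T : i != j -> i \notin T -> j \notin T ->
  pos_sign i T * pos_sign j (i |: T) = - (pos_sign j T * pos_sign i (j |: T)) :> A.
Proof.
move=> ij iT jT; rewrite !pos_sign_add//.
have com (x y : {set 'I_r}) : GRing.comm (pos_sign i x) (pos_sign j y : A).
  by apply: commr_sign.
case: (ltngtP i j) => [l|l|/val_inj e].
- by rewrite mulN1r mul1r mulrN com.
- by rewrite mulN1r mul1r mulrN opprK com.
- by rewrite e eqxx in ij.
Qed.

End Signs.

(** The terms cancel in pairs i < j and j < i. Nothing is divided by 2, hence the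
    exclusion of the diagonal. *)
Lemma sum_antisym (V : zmodType) (r : nat) (Q : {set 'I_r})
    (F : 'I_r -> 'I_r -> V) :
  (forall i j, i \in Q -> j \in Q -> i != j -> F i j = - F j i) ->
  \sum_(i in Q) \sum_(j in Q :\ i) F i j = 0.
Proof.
move=> as_; pose lt (i j : 'I_r) := (i < j)%N.
have split i : i \in Q -> \sum_(j in Q :\ i) F i j =
   \sum_(j in Q | lt i j) F i j + \sum_(j in Q | lt j i) F i j.
  move=> iQ; rewrite (bigID (lt i)) /=; congr (_ + _); apply: eq_bigl => j.
    rewrite !inE /lt; case: (eqVneq j i) => [->|] //=.
    by rewrite ltnn andbF.
  rewrite !inE /lt -leqNgt ltn_neqAle -val_eqE /=.
  by case: (_ == _); rewrite ?andbF.
rewrite (eq_bigr _ split) big_split /=.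
rewrite [X in _ + X](exchange_big_dep (mem Q)) /=; last by move=> i j _ /andP[].
rewrite -big_split big1 //= => i iQ.
apply/eqP; rewrite addr_eq0 -sumrN; apply/eqP.
apply: eq_big => j; first by rewrite iQ.
by move=> /andP[jQ lij]; apply: as_ => //; apply: contraTneq lij => ->; rewrite /lt ltnn.
Qed.

Section CechDifferential.
Variables (A : comPzRingType) (r : nat) (a : 'I_r -> A).

Section OneModule.
Variable (N : lmodType A).
Implicit Types (c : cochain a N) (s t : {set 'I_r}).

Lemma cech_res_linear t i : i \in t -> linear (@cech_res A r a N t i).
Proof.
move=> it k q1 q2; have [x [y [m [-> ->]]]] := frac_common q1 q2.
rewrite fracZ fracD !cech_resE// fracZ fracD scalerDr !scalerA.
by rewrite (mulrC k).
Qed.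

Lemma cech_res_lin t i : i \in t ->
  exists h : {linear localization N (cech_den a (t :\ i))
                     -> localization N (cech_den a t)},
    forall q, cech_res q = h q.
Proof.
by move=> it; have [h e] := linear_fun (cech_res_linear it); exists h => q; rewrite e.
Qed.

Lemma eq_cech_d c c' : (forall s, c s = c' s) -> forall t, cech_d c t = cech_d c' t.
Proof. by move=> e t; apply: eq_bigr => i _; rewrite e. Qed.

Lemma cech_d0 t : cech_d ((fun=> 0) : cochain a N) t = 0.
Proof.
apply: big1 => i it; have [h ->] := cech_res_lin it.
by rewrite raddf0 scaler0.
Qed.

Lemma cech_dD c c' t :
  cech_d (fun s => c s + c' s) t = cech_d c t + cech_d c' t.
Proof.
rewrite -big_split; apply: eq_bigr => i it; have [h e] := cech_res_lin it.
by rewrite !e raddfD scalerDr.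
Qed.

Lemma cech_dZ k c t : cech_d (fun s => k *: c s) t = k *: cech_d c t.
Proof.
rewrite scaler_sumr; apply: eq_bigr => i it; have [h e] := cech_res_lin it.
by rewrite !e linearZ !scalerA mulrC.
Qed.

Lemma cech_dB c c' t :
  cech_d (fun s => c s - c' s) t = cech_d c t - cech_d c' t.
Proof.
rewrite -scaleN1r -cech_dZ -cech_dD; apply: eq_cech_d => s.
by rewrite scaleN1r.
Qed.

Lemma cech_d_sum (I : finType) (P : pred I) (F : I -> cochain a N) t :
  cech_d (fun s => \sum_(k | P k) F k s) t = \sum_(k | P k) cech_d (F k) t.
Proof.
rewrite exchange_big; apply: eq_bigr => i it; have [h e] := cech_res_lin it.
rewrite e raddf_sum scaler_sumr; apply: eq_bigr => k _.
by rewrite e.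
Qed.

Lemma cech_d_supp c p : (forall s, #|s| != p -> c s = 0) ->
  forall t, #|t| != p.+1 -> cech_d c t = 0.
Proof.
move=> sc t tp; apply: big1 => i it; have [h ->] := cech_res_lin it.
rewrite sc ?raddf0 ?scaler0//; apply: contraNneq tp => <-.
by rewrite (cardsD1 i t) it.
Qed.

(** On the right-hand side the set t :\ i :\ j occurs only through a numerator
    and an exponent, whose types do not depend on it; this makes the exchange of
    i and j a plain rewriting. *)
Lemma cech_res2E c t i j : i \in t -> j \in t :\ i ->
  let u := repr (c (t :\ i :\ j)) in
  cech_res (cech_res (c (t :\ i :\ j)))
    = frac (cech_den a t) ((a i * a j) ^+ u.2 *: u.1) u.2.
Proof.
move=> it jt u.
have -> : c (t :\ i :\ j) = frac _ u.1 u.2 by rewrite /frac -surjective_pairing reprK.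
by rewrite [X in cech_res X]cech_resE// cech_resE// exprMn scalerA.
Qed.

Lemma cech_dd c t : cech_d (cech_d c) t = 0.
Proof.
pose u s := repr (c s).
pose G (i j : 'I_r) := frac (cech_den a t)
  ((a i * a j) ^+ (u (t :\ i :\ j)).2 *: (u (t :\ i :\ j)).1) (u (t :\ i :\ j)).2.
pose F i j := (pos_sign i t * pos_sign j (t :\ i)) *: G i j.
transitivity (\sum_(i in t) \sum_(j in t :\ i) F i j).
  apply: eq_bigr => i it; have [h e] := cech_res_lin it.
  rewrite e raddf_sum scaler_sumr; apply: eq_bigr => j jt.
  by rewrite /= linearZ scalerA -e cech_res2E.
apply: sum_antisym => i j it jt ij; rewrite /F -scaleNr.
have s2 : t :\ i :\ j = t :\ j :\ i by apply/setP => k; rewrite !inE andbCA.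
have -> : G i j = G j i by rewrite /G s2 (mulrC (a i)).
apply: (congr1 (fun k : A => k *: _)).
pose T := t :\ i :\ j.
have iT : i \notin T by rewrite !inE eqxx andbF.
have jT : j \notin T by rewrite !inE eqxx.
have ti : t :\ i = j |: T by rewrite finset.setD1K// !inE jt eq_sym ij.
have tj : t :\ j = i |: T by rewrite /T s2 finset.setD1K// !inE it ij.
rewrite -(pos_signD1 _ i t) -(pos_signD1 _ j t) ti tj !pos_signU1.
rewrite [LHS]mulrC [in RHS]mulrC.
by apply: pos_sign_swap; rewrite // eq_sym.
Qed.

End OneModule.

(** * The long exact sequence of Cech cohomology *)

Lemma cech_res_map (N N' : lmodType A) (h : {linear N -> N'}) (t : {set 'I_r}) i
    (q : localization N (cech_den a (t :\ i))) : i \in t ->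
  loc_map h (cech_res q) = cech_res (loc_map h q).
Proof.
move=> it; have [x [k ->]] := fracE q.
by rewrite [X in _ = cech_res X]loc_mapE !cech_resE// loc_mapE linearZ.
Qed.

Lemma cech_d_map (N N' : lmodType A) (h : {linear N -> N'}) (c : cochain a N) t :
  cech_d (fun s => loc_map h (c s)) t = loc_map h (cech_d c t).
Proof.
rewrite raddf_sum; apply: eq_bigr => i it.
by rewrite /= linearZ /= cech_res_map.
Qed.

Lemma cohom_eq0_gt (N : lmodType A) p : (r < p)%N -> cohom_eq0 a N p.
Proof.
move=> rp c [sc _]; exists (fun=> 0); split=> // t; rewrite cech_d0 sc//.
rewrite neq_ltn (leq_ltn_trans _ rp)//.
by rewrite -[X in (_ <= X)%N](card_ord r) max_card.
Qed.

Lemma cochain_lift (N N' : lmodType A) (h : {linear N -> N'}) (c : cochain a N')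
    (P : pred {set 'I_r}) :
  (forall s, exists q, loc_map h q = c s) -> (forall s, P s -> c s = 0) ->
  exists c' : cochain a N,
    (forall s, P s -> c' s = 0) /\ forall s, loc_map h (c' s) = c s.
Proof.
move=> ex sc.
exists (fun s => if P s then 0 else projT1 (cid (ex s))); split=> s.
  by move->.
by case: ifP => [/sc ->|_]; rewrite ?raddf0//; case: (cid _).
Qed.

Section ExactSequence.
Variables (K W N : lmodType A) (g : {linear K -> W}) (h : {linear W -> N}).
Hypotheses (inj_g : injective g) (hg0 : forall k, h (g k) = 0).
Hypothesis ker_h : forall w, h w = 0 -> exists k, g k = w.

(** The part of the long exact sequence H^p(W) -> H^p(N) -> H^(p+1)(K), for a
    map [h] that is not assumed to be onto: it is enough that the coordinates
    of the cocycle at hand are reached. *)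
Lemma coboundary_lift p (c : cochain a N) :
  cohom_eq0 a W p -> cohom_eq0 a K p.+1 -> cocycle p c ->
  (forall s, exists q, loc_map h q = c s) -> coboundary p c.
Proof.
move=> HW HK [sc dc] /cochain_lift /(_ sc)[c' [sc' ec]].
have [t|t tp|k [sk ek]] := @cochain_lift K W g (cech_d c') (fun s => #|s| != p.+1).
- apply: (loc_map_exact ker_h); rewrite -cech_d_map -(dc t).
  exact: eq_cech_d.
- exact: (cech_d_supp sc').
have [|b [sb eb]] := HK k.
  split=> // t; apply: (loc_map_inj inj_g).
  by rewrite -cech_d_map raddf0 (eq_cech_d ek) cech_dd.
have [|e [se ee]] := HW (fun s => c' s - loc_map g (b s)).
  split=> [s sp|t]; first by rewrite sc'// sb// !raddf0 addr0.
  by rewrite cech_dB cech_d_map -eb ek subrr.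
exists (fun s => loc_map h (e s)); split=> [s /se ->|t]; first exact: raddf0.
by rewrite cech_d_map -ee raddfB /= loc_map_comp0// subr0 ec.
Qed.

(** Exactness of H^p(K) -> H^p(W) -> H^p(N) in the middle: subtract from a cocycle
    of W the coboundary of a lift of a primitive of its image. *)
Lemma cohom_eq0_ext p : (forall y, exists x, h x = y) ->
  cohom_eq0 a K p -> cohom_eq0 a N p -> cohom_eq0 a W p.
Proof.
move=> sh HK HN c [sc dc].
have [|b [sb eb]] := HN (fun s => loc_map h (c s)).
  split=> [s /sc ->|t]; first exact: raddf0.
  by rewrite cech_d_map dc raddf0.
have [b' [sb' eb']] := cochain_lift (fun s => loc_map_surj sh (b s)) sb.
have [t|t tp|k [sk ek]] := @cochain_lift K W g (fun t => c t - cech_d b' t)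
  (fun s => #|s| != p).
- apply: (loc_map_exact ker_h); rewrite raddfB /= -cech_d_map (eq_cech_d eb').
  by rewrite -eb subrr.
- rewrite sc// sub0r; apply/eqP; rewrite oppr_eq0; apply/eqP.
  case: p tp {HN HK sc sb} sb' => [_|p tp] sb'; last first.
    by apply: (cech_d_supp _ tp) => s sp; apply: sb'; rewrite eqSS.
  by rewrite (@eq_cech_d _ b' (fun=> 0)) ?cech_d0// => s; exact: sb'.
have [|e [se ee]] := HK k.
  split=> // t; apply: (loc_map_inj inj_g).
  by rewrite -cech_d_map raddf0 (eq_cech_d ek) cech_dB dc cech_dd subrr.
exists (fun s => b' s + loc_map g (e s)); split=> [s sp|t].
  by rewrite sb'// se// raddf0 addr0.
by rewrite cech_dD cech_d_map -ee ek addrC subrK.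
Qed.

End ExactSequence.
End CechDifferential.

(** * Submodules and quotient modules *)

Section SubQuotient.
Variables (A : pzRingType) (V : lmodType A).

Definition is_submod (D : V -> Prop) : Prop :=
  D 0 /\ forall c x y, D x -> D y -> D (c *: x + y).

Lemma submod_of (D : V -> Prop) : is_submod D ->
  exists P : submodClosed V, forall x, x \in P <-> D x.
Proof.
move=> [D0 DL]; pose p : {pred V} := fun x => `[< D x >].
have pc : submod_closed p.
  by split=> [|c x y /asboolP Dx /asboolP Dy]; apply/asboolP => //; exact: DL.
pose P : submodClosed V := HB.pack p (GRing.isSubmodClosed.Build A V p pc).
by exists P => x; split=> /asboolP.
Qed.

Lemma submodule_val_linear (P : submodClosed V) : linear (val : submodule P -> V).
Proof. by []. Qed.

Lemma sub_exists (D : V -> Prop) : is_submod D ->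
  exists (K : lmodType A) (g : {linear K -> V}),
    injective g /\ forall x, D x <-> exists k, g k = x.
Proof.
move=> /submod_of[P DP]; have [g eg] := linear_fun (@submodule_val_linear P).
exists (submodule P), g; split=> [x y|x]; first by rewrite !eg => /val_inj.
split=> [/DP Px|[k <-]]; first by exists (Submodule Px); rewrite eg.
by apply/DP; rewrite eg; case: k.
Qed.

End SubQuotient.

Section QuotientModule.
Local Open Scope quotient_scope.
Variables (A : pzRingType) (V : lmodType A) (P : submodClosed V).

Definition congr_mod (x y : V) : bool := x - y \in P.

Lemma congr_mod_refl : reflexive congr_mod.
Proof. by move=> x; rewrite /congr_mod subrr rpred0. Qed.
Lemma congr_mod_sym : symmetric congr_mod.
Proof.
have sub x y : x - y \in P -> y - x \in P.
  by move=> xy; rewrite -opprB -scaleN1r rpredZ.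
by move=> x y; apply/idP/idP; exact: sub.
Qed.
Lemma congr_mod_trans : transitive congr_mod.
Proof. by move=> y x z xy yz; rewrite /congr_mod -(subrKA y) rpredD. Qed.

Canonical congr_mod_equiv :=
  EquivRel congr_mod congr_mod_refl congr_mod_sym congr_mod_trans.

Definition quot_mod := {eq_quot congr_mod_equiv}.
HB.instance Definition _ : EqQuotient _ congr_mod_equiv quot_mod :=
  EqQuotient.on quot_mod.
HB.instance Definition _ := Choice.on quot_mod.

Definition cls (x : V) : quot_mod := \pi_quot_mod x.

Lemma cls_eq x y : (x - y \in P) = (cls x == cls y).
Proof. by rewrite /cls eqmodE. Qed.

Lemma clsE (q : quot_mod) : cls (repr q) = q.
Proof. exact: reprK. Qed.

Lemma repr_cls x : x - repr (cls x) \in P.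
Proof. by rewrite cls_eq clsE. Qed.

Definition quot_zero : quot_mod := cls 0.
Definition quot_opp (q : quot_mod) : quot_mod := cls (- repr q).
Definition quot_add (q1 q2 : quot_mod) : quot_mod := cls (repr q1 + repr q2).
Definition quot_scale (c : A) (q : quot_mod) : quot_mod := cls (c *: repr q).

Lemma quot_oppE x : quot_opp (cls x) = cls (- x).
Proof.
by apply/eqP; rewrite -cls_eq opprK addrC repr_cls.
Qed.

Lemma quot_addE x y : quot_add (cls x) (cls y) = cls (x + y).
Proof.
apply/esym/eqP; rewrite -cls_eq opprD addrACA.
by apply: rpredD; exact: repr_cls.
Qed.

Lemma quot_scaleE c x : quot_scale c (cls x) = cls (c *: x).
Proof.
by apply/esym/eqP; rewrite -cls_eq -scalerBr rpredZ// repr_cls.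
Qed.

Lemma quot_addC : commutative quot_add.
Proof. by move=> x y; rewrite -[x]clsE -[y]clsE !quot_addE addrC. Qed.
Lemma quot_addA : associative quot_add.
Proof. by move=> x y z; rewrite -[x]clsE -[y]clsE -[z]clsE !quot_addE addrA. Qed.
Lemma quot_add0 : left_id quot_zero quot_add.
Proof. by move=> x; rewrite -[x]clsE quot_addE add0r. Qed.
Lemma quot_addN : left_inverse quot_zero quot_opp quot_add.
Proof. by move=> x; rewrite -[x]clsE quot_oppE quot_addE addNr. Qed.

HB.instance Definition _ :=
  GRing.isZmodule.Build quot_mod quot_addA quot_addC quot_add0 quot_addN.

Lemma quot_scaleA c d q : quot_scale c (quot_scale d q) = quot_scale (c * d) q.
Proof. by rewrite -[q]clsE !quot_scaleE scalerA. Qed.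
Lemma quot_scale1 : left_id 1 quot_scale.
Proof. by move=> q; rewrite -[q]clsE quot_scaleE scale1r. Qed.
Lemma quot_scaleDr : right_distributive quot_scale +%R.
Proof.
move=> c x y; rewrite -[x]clsE -[y]clsE /GRing.add /=.
by rewrite !(quot_scaleE, quot_addE) scalerDr.
Qed.
Lemma quot_scaleDl q : {morph quot_scale^~ q : c d / c + d}.
Proof.
move=> c d; rewrite -[q]clsE [RHS]/GRing.add /=.
by rewrite !(quot_scaleE, quot_addE) scalerDl.
Qed.

HB.instance Definition _ := GRing.Zmodule_isLmodule.Build A quot_mod
  quot_scaleA quot_scale1 quot_scaleDr quot_scaleDl.

Lemma cls_linear : linear cls.
Proof.
move=> c x y; rewrite [RHS]/GRing.add /= [_ *: cls x]/GRing.scale /=.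
by rewrite quot_scaleE quot_addE.
Qed.

End QuotientModule.

Lemma quot_exists (A : pzRingType) (V : lmodType A) (D : V -> Prop) :
  is_submod D -> exists (Q : lmodType A) (h : {linear V -> Q}),
    (forall y, exists x, h x = y) /\ forall x, D x <-> h x = 0.
Proof.
move=> /submod_of[P DP]; have [h eh] := linear_fun (@cls_linear A V P).
exists (quot_mod P), h; split=> [y|x]; first by exists (repr y); rewrite eh clsE.
rewrite -DP -(linear0 h) !eh -{1}[x]subr0 cls_eq.
by split=> /eqP.
Qed.

(** * Vanishing of cohomology and annihilators *)

Definition kills (A : pzRingType) (J : A -> Prop) (N : lmodType A) : Prop :=
  forall c, J c -> forall x : N, c *: x = 0.

Definition ann (A : pzRingType) (N : lmodType A) (c : A) : Prop :=
  forall x : N, c *: x = 0.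

Lemma factor_inj (A : pzRingType) (K W N : lmodType A) (g : {linear K -> N})
    (h : {linear W -> N}) :
  injective g -> (forall w, exists k, g k = h w) ->
  exists h' : {linear W -> K}, forall w, g (h' w) = h w.
Proof.
move=> inj_g /choice[u eu].
have lu : linear u by move=> c x y; apply: inj_g; rewrite linearP !eu linearP.
by have [h' eh'] := linear_fun lu; exists h' => w; rewrite eh' eu.
Qed.

Section VanishingByAnnihilator.
Variables (A : comPzRingType) (r : nat) (a : 'I_r -> A) (p : nat).
Variable aa : A -> Prop.
Hypothesis vanish_above :
  forall N : lmodType A, kills aa N -> cohom_eq0 a N p.+1.

(** [aa] is an ideal in the background, ann P in the application: the modules at
    hand are all killed by it, which makes H^p right exact on them. *)
Definition good (N : lmodType A) : Prop := kills aa N /\ cohom_eq0 a N p.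

Lemma good_ext (K W N : lmodType A) (g : {linear K -> W}) (h : {linear W -> N}) :
  kills aa W -> injective g -> (forall y, exists x, h x = y) ->
  (forall w, h w = 0 <-> exists k, g k = w) ->
  good K -> good N -> good W.
Proof.
move=> kW ig sh ex [_ HK] [_ HN]; split=> //.
by apply: (@cohom_eq0_ext _ _ a K W N g h) => // w /ex.
Qed.

Lemma good_prod (V W : lmodType A) : good V -> good W -> good (V * W)%type.
Proof.
move=> gV gW.
have li : linear (fun v : V => (v, 0 : W)).
  by move=> c x y; congr pair; rewrite /= scaler0 addr0.
have ls : linear (@snd V W) by [].
have [i ei] := linear_fun li; have [s es] := linear_fun ls.
apply: (@good_ext V _ W i s) => //.
- move=> c /[dup] /gV.1 cV /gW.1 cW [v w].
  by congr pair; rewrite ?cV ?cW.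
- by move=> x y; rewrite !ei => -[].
- by move=> w; exists (0, w); rewrite es.
- move=> [v w]; rewrite es /=; split=> [->|[k]]; last by rewrite ei => -[].
  by exists v; rewrite ei.
Qed.

(** The elements reached from good modules. They form a submodule because a finite
    sum of good modules is good. *)
Definition covered (N : lmodType A) (x : N) : Prop :=
  exists W, good W /\ exists (h : {linear W -> N}) (w : W), h w = x.

Lemma coveredP (N : lmodType A) (x y : N) : covered x -> covered y ->
  exists W, good W /\
    exists (h : {linear W -> N}) (w w' : W), h w = x /\ h w' = y.
Proof.
move=> [V [gV [g [v <-]]]] [W [gW [h [w <-]]]].
exists (V * W)%type; split; first exact: good_prod.
have lf : linear (fun z : V * W => g z.1 + h z.2).
  by move=> c z z'; rewrite /= !linearP scalerDr addrACA.
have [f ef] := linear_fun lf.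
by exists f, (v, 0), (0, w); rewrite !ef /= !raddf0 addr0 add0r.
Qed.

Lemma covered_submod (N : lmodType A) :
  (exists W, good W) -> is_submod (@covered N).
Proof.
move=> [W gW]; split.
  have l0 : linear (fun _ : W => 0 : N) by move=> c x y /=; rewrite scaler0 addr0.
  by have [h eh] := linear_fun l0; exists W; split=> //; exists h, 0; rewrite eh.
move=> c x y /coveredP/[apply] -[V [gV [h [v [v' [<- <-]]]]]].
by exists V; split=> //; exists h, (c *: v + v'); rewrite linearP.
Qed.

(** A cochain has finitely many coordinates, so that a single good module W covers
    all of their numerators; the obstruction to lifting a cocycle to W lies in
    H^(p+1) of the kernel, which vanishes. *)
Lemma good_covered (N : lmodType A) :
  kills aa N -> (forall x : N, covered x) -> good N.
Proof.
move=> kN cov; split=> // c cc.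
have [W [gW [h ch]]] : exists W, good W /\ exists h : {linear W -> N},
    forall s, s \in enum {set 'I_r} -> exists w, h w = (repr (c s)).1.
  elim: (enum _) => [|s l [V [gV [g cg]]]].
    by have [W [gW [h _]]] := cov 0; exists W; split=> //; exists h.
  have [W [gW [h [w ew]]]] := cov (repr (c s)).1.
  have lf : linear (fun z : V * W => g z.1 + h z.2).
    by move=> k z z'; rewrite /= !linearP scalerDr addrACA.
  have [f ef] := linear_fun lf.
  exists (V * W)%type; split; first exact: good_prod.
  exists f => t; rewrite inE => /orP[/eqP ->|/cg[v ev]].
    by exists (0, w); rewrite ef /= raddf0 add0r.
  by exists (v, 0); rewrite ef /= raddf0 addr0.
have sK : is_submod (fun w => h w = 0).
  by split=> [|k x y hx hy]; rewrite ?raddf0// linearP hx hy scaler0 addr0.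
have [K [g [ig eg]]] := sub_exists sK.
have hg0 k : h (g k) = 0 by apply/eg; exists k.
apply: (@coboundary_lift _ _ a K W N g h) => //.
- by move=> w /eg.
- exact: gW.2.
- apply: vanish_above => k ak x; apply: ig.
  by rewrite linearZ raddf0 /= gW.1.
- move=> s; have [|w ew] := ch s; first by rewrite mem_enum.
  exists (frac _ w (repr (c s)).2).
  by rewrite loc_mapE ew /frac -surjective_pairing reprK.
Qed.

Lemma good_quotient (W N : lmodType A) (h : {linear W -> N}) :
  (forall y, exists x, h x = y) -> good W -> good N.
Proof.
move=> sh gW; apply: good_covered => [c /gW.1 cW y|y]; have [x <-] := sh y.
  by rewrite -linearZ cW raddf0.
by exists W; split=> //; exists h, x.
Qed.

(** In the spirit of Gruson's theorem on filtrations by quotients of sums of a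
    faithful finitely generated module; the role of the faithful module is played
    by P over A / ann P. *)
Lemma good_by_annihilator (m : nat) (P : lmodType A) (e : 'I_m -> P) :
  (forall x, exists c : 'I_m -> A, x = \sum_i c i *: e i) -> good P ->
  forall N, kills aa N -> kills (ann P) N -> good N.
Proof.
elim: m P e => [|m IHm] P e gen gP N kN annN.
  apply: good_covered => // x; have -> : x = 0.
    rewrite -[x]scale1r annN// => z.
    by have [c ->] := gen z; rewrite big_ord0 scaler0.
  by case: (covered_submod N (ex_intro _ P gP)).
(* Modules killed by ann(e j): here the number of generators drops. *)
have step1 j (N1 : lmodType A) : kills aa N1 ->
    kills (fun c => c *: e j = 0) N1 -> good N1.
  move=> kN1 annN1.
  have sD : is_submod (fun x : P => exists c, x = c *: e j).
    split=> [|k _ _ [c ->] [d ->]]; first by exists 0; rewrite scale0r.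
    by exists (k * c + d); rewrite scalerDl scalerA.
  have [Q [q [sq kq]]] := quot_exists sD.
  have gQ : good Q := good_quotient sq gP.
  have qej : q (e j) = 0 by apply/kq; exists 1; rewrite scale1r.
  have genQ x : exists c : 'I_m -> A, x = \sum_i c i *: q (e (lift j i)).
    have [y <-] := sq x; have [c ->] := gen y.
    exists (fun i => c (lift j i)); rewrite (bigD1_ord j)//= raddfD /= linearZ /= qej.
    rewrite scaler0 add0r raddf_sum; apply: eq_bigr => i _.
    by rewrite /= linearZ.
  have goodQ := IHm Q _ genQ gQ.
  (* K is the covered part of N1, and Q1 the rest. *)
  have [K [g [ig eg]]] := sub_exists (covered_submod N1 (ex_intro _ P gP)).
  have [Q1 [q1 [sq1 kq1]]] := quot_exists (covered_submod N1 (ex_intro _ P gP)).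
  apply: (@good_ext K N1 Q1 g q1) => //.
  - by move=> w; rewrite -kq1; exact: eg.
  - apply: good_covered => [c ac x|k].
      by apply: ig; rewrite linearZ raddf0 /= kN1.
    have [W [gW [h [w hw]]]] : covered (g k) by apply/eg; exists k.
    have [|h' eh'] := @factor_inj _ K W N1 g h ig.
      by move=> w'; apply/eg; exists W; split=> //; exists h, w'.
    by exists W; split=> //; exists h', w; apply: ig; rewrite eh'.
  - apply: goodQ => [c ac y|b bQ y]; have [x <-] := sq1 y; rewrite -linearZ.
      by rewrite kN1// raddf0.
    apply/kq1; have bP z : exists c, b *: z = c *: e j.
      by apply/kq; rewrite linearZ; exact: bQ.
    have [d ed] := choice bP.
    (* The coefficient d z is unique up to ann(e j), which kills x. *)
    have kd c c' z : c *: e j = c' *: e j -> c *: z = c' *: z :> N1.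
      move=> ecc; apply/eqP; rewrite -subr_eq0 -scalerBl annN1//.
      by rewrite scalerBl ecc subrr.
    have ld : linear (fun z => d z *: x).
      move=> k z z'; rewrite scalerA -scalerDl; apply: kd.
      by rewrite scalerDl -scalerA -!ed scalerDr !scalerA (mulrC b).
    have [h eh] := linear_fun ld.
    exists P; split=> //; exists h, (e j); rewrite eh.
    by apply: kd; rewrite -ed.
(* Modules killed by the intersection of several ann(e j): split off the
   submodule killed by the intersection of all but one of them. *)
have step2 (l : seq 'I_m.+1) : forall N1 : lmodType A, kills aa N1 ->
    kills (fun c => forall j, j \in l -> c *: e j = 0) N1 -> good N1.
  elim: l => [|j l IHl] N1 kN1 annN1.
    apply: good_covered => // x; rewrite -[x]scale1r annN1//.
    by case: (covered_submod N1 (ex_intro _ P gP)).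
  have sD : is_submod (fun x : N1 => forall c,
      (forall j, j \in l -> c *: e j = 0) -> c *: x = 0).
    split=> [c _|k x y Dx Dy c cl]; first exact: scaler0.
    by rewrite scalerDr scalerA mulrC -scalerA Dx// Dy// scaler0 addr0.
  have [K [g [ig eg]]] := sub_exists sD.
  have [Q [q [sq kq]]] := quot_exists sD.
  apply: (@good_ext K N1 Q g q) => //.
  - by move=> w; rewrite -kq; exact: eg.
  - apply: IHl => [c ac x|c cl x]; apply: ig; rewrite linearZ raddf0 /=.
      exact: kN1.
    by have /eg gx : exists k, g k = g x; [exists x | exact: gx].
  - apply: (step1 j) => [c ac y|b bj y]; have [x <-] := sq y; rewrite -linearZ.
      by rewrite kN1// raddf0.
    apply/kq => c cl; rewrite scalerA; apply: annN1 => i.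
    rewrite inE => /orP[/eqP ->|il]; first by rewrite -scalerA bj scaler0.
    by rewrite mulrC -scalerA cl// scaler0.
apply: (step2 (enum 'I_m.+1)) => // c cl x; apply: annN => z.
have [d ->] := gen z; rewrite scaler_sumr big1// => i _.
by rewrite scalerA mulrC -scalerA cl ?scaler0// mem_enum.
Qed.

End VanishingByAnnihilator.

(** Descending induction on i, from the range i > r where cohomology vanishes for
    lack of cochains. *)
Lemma cohom_eq0_annihilator (A : comPzRingType) (r : nat) (a : 'I_r -> A)
    (P N : lmodType A) (t : nat) :
  finitely_generated P -> kills (ann P) N ->
  (forall i, (t <= i)%N -> cohom_eq0 a P i) ->
  forall i, (t <= i)%N -> cohom_eq0 a N i.
Proof.
move=> [m [e gen]] + HP i.
have [k ki] := ubnP (r.+1 - i)%N.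
elim: k i N ki => // k IHk i N ki annN ti.
have [ri|ir] := ltnP r i; first exact: cohom_eq0_gt.
have van (V : lmodType A) : kills (ann P) V -> cohom_eq0 a V i.+1.
  by move=> kV; apply: IHk => //; lia.
have gP : good a i (ann P) P by split; [move=> c | exact: HP].
by case: (good_by_annihilator van gen gP annN annN).
Qed.

Lemma cd_le_annihilator (A : comPzRingType) (r : nat) (a : 'I_r -> A)
    (P N : lmodType A) :
  finitely_generated P -> kills (ann P) N -> (cd a N <= cd a P)%E.
Proof.
move=> fgP kN; have [_] := esupP [set p%:Z%:E | p in [set p | ~ cohom_eq0 a N p]]%classic.
apply => _ [p Hp <-]; have [[q pq Hq]|no] :=
  pselect (exists2 q : nat, (p <= q)%N & ~ cohom_eq0 a P q).
  have [ub _] := esupP [set p%:Z%:E | p in [set p | ~ cohom_eq0 a P p]]%classic.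
  by apply: (@le_trans _ _ (q%:Z%:E)); [rewrite lee_fin lez_nat | apply: ub; exists q].
case: Hp; apply: (cohom_eq0_annihilator fgP kN (t := p)) => // i pi.
by apply: contrapT => Hi; apply: no; exists i.
Qed.

(** * The Koszul complex *)

(** The form of [pos_sign_swap] which the contraction below needs: one factor of
    each side is moved across, signs being their own inverses. *)
Lemma pos_sign_swap2 (A : comPzRingType) (n : nat) (i j : 'I_n) (T : {set 'I_n}) :
  i != j -> i \notin T -> j \notin T ->
  pos_sign i T * pos_sign j T = - (pos_sign j (i |: T) * pos_sign i (j |: T)) :> A.
Proof.
move=> ij iT jT; have sw := pos_sign_swap A ij iT jT.
rewrite -[LHS]mulr1 -(pos_sign2 A j (i |: T)) mulrACA sw.
by rewrite mulNr mulrACA pos_sign2 mul1r mulrC.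
Qed.

Section Koszul.
Variables (A : comPzRingType) (n : nat) (X : 'I_n -> A) (V : lmodType A).
Implicit Types (y : {set 'I_n} -> V) (T : {set 'I_n}).

Definition kos y T : V := \sum_(i in ~: T) (pos_sign i T * X i) *: y (i |: T).

Lemma eq_kos y y' : (forall T, y T = y' T) -> forall T, kos y T = kos y' T.
Proof. by move=> e T; apply: eq_bigr => i _; rewrite e. Qed.

Lemma kosB y y' T : kos (fun T => y T - y' T) T = kos y T - kos y' T.
Proof. by rewrite -sumrB; apply: eq_bigr => i _; rewrite scalerBr. Qed.

Lemma kos_kos y T : kos (kos y) T = 0.
Proof.
pose F i j := (pos_sign i T * pos_sign j (i |: T) * (X i * X j)) *: y (j |: (i |: T)).
transitivity (\sum_(i in ~: T) \sum_(j in ~: T :\ i) F i j).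
  apply: eq_bigr => i iT; rewrite scaler_sumr; apply: eq_big => j.
    by rewrite !inE negb_or.
  by rewrite scalerA mulrACA.
apply: sum_antisym => i j; rewrite !inE => iT jT ij.
by rewrite /F finset.setUCA pos_sign_swap// mulNr scaleNr (mulrC (X i)).
Qed.

Definition contract (i : 'I_n) (u : V -> V) y T : V :=
  if i \in T then pos_sign i T *: u (y (T :\ i)) else 0.

(** Wedging with the i-th basis vector, divided by X_i, contracts the Koszul
    complex of a module on which X_i is invertible. *)
Lemma kos_contract (i : 'I_n) (u : {linear V -> V}) y T :
  (forall v, X i *: u v = v) ->
  kos (contract i u y) T + contract i u (kos y) T = y T.
Proof.
move=> Xu.
rewrite {2}/contract; case: ifPn => iT; last first.
  rewrite addr0 /kos (big_setD1 i) ?inE//= big1 ?addr0.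
    rewrite /contract !inE eqxx /= pos_signU1 setU1K//.
    by rewrite scalerA mulrAC pos_sign2 mul1r Xu.
  move=> j; rewrite !inE => /andP[ji _]; rewrite /contract !inE.
  by rewrite (negbTE iT) eq_sym (negbTE ji) scaler0.
rewrite [kos y _]/kos (big_setD1 i) ?inE ?eqxx//= raddfD /= linearZ /= scalerDr.
rewrite finset.setD1K// pos_signD1 [X in X + _ *: _]scalerA mulrA pos_sign2 mul1r Xu.
rewrite addrCA addrC -[RHS]add0r; congr (_ + _).
have eT : ~: (T :\ i) :\ i = ~: T.
  by apply/setP => j; rewrite !inE; case: eqVneq => [->|] /=; rewrite ?iT.
rewrite eT raddf_sum scaler_sumr -big_split big1//= => j.
rewrite inE => jT; rewrite /contract inE iT orbT.
have ij : i != j by apply: contraNneq jT => <-.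
have eU : (j |: T) :\ i = j |: (T :\ i).
  apply/setP => k; rewrite !inE; case: (eqVneq k j) => [->|]//=.
  by rewrite eq_sym ij.
have sg : pos_sign i T * pos_sign j (T :\ i)
          = - (pos_sign j T * pos_sign i (j |: T)) :> A.
  rewrite -(pos_signD1 _ i T) -(pos_signD1 _ i (j |: T)) eU.
  have := @pos_sign_swap2 A n i j (T :\ i) ij; rewrite finset.setD1K//.
  by apply; rewrite !inE ?eqxx// (negbTE jT) andbF.
rewrite [X in _ + _ *: X]linearZ /= !scalerA eU (mulrA (pos_sign i T)) sg.
by rewrite mulNr scaleNr [X in X *: _ - _]mulrAC subrr.
Qed.

End Koszul.

(** The Koszul differential is a combination of scalar multiplications, with which
    the linear map [cech_d] commutes. *)
Lemma cech_d_kos (A : comPzRingType) (n : nat) (X : 'I_n -> A) (N : lmodType A)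
    (y : {set 'I_n} -> cochain X N) T t :
  cech_d (fun s => kos X (fun T' => y T' s) T) t
  = kos X (fun T' => cech_d (y T') t) T.
Proof. by rewrite cech_d_sum; apply: eq_bigr => i _; rewrite cech_dZ. Qed.

Section Division.
Variables (A : comPzRingType) (N : lmodType A) (a : A).

(** Multiplication by 1 / a. *)
Definition loc_div (q : localization N a) : localization N a :=
  frac a (repr q).1 (repr q).2.+1.

Lemma loc_divE x k : loc_div (frac a x k) = frac a x k.+1.
Proof.
have [l e] := repr_frac a x k; apply/fracP; exists l.
by rewrite !addnS !exprS -!scalerA e.
Qed.

Lemma loc_div_linear : linear loc_div.
Proof.
move=> c q1 q2; have [x [y [k [-> ->]]]] := frac_common q1 q2.
by rewrite fracZ fracD !loc_divE fracZ fracD.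
Qed.

HB.instance Definition _ := GRing.isLinear.Build A _ _ *:%R loc_div loc_div_linear.

Lemma loc_divK q : a *: loc_div q = q.
Proof.
have [x [k ->]] := fracE q.
by rewrite loc_divE fracZ; apply: (frac_expand a 1).
Qed.

End Division.

(** * Homogeneous components *)

Section Grading.
Variables (R S : comPzRingType) (f : {rmorphism R -> S}).
Variables (S_ : nat -> zmodClosed S) (n : nat) (X : 'I_n -> S).
Hypothesis hS : standard_graded f S_ X.
Variables (M : lmodType S) (M_ : int -> submodClosed (res_scalars f M)).
Hypothesis hM : graded_module S_ M_.
Implicit Types (x : M) (mu nu : int).

Lemma gr0 mu : (0 : M) \in M_ mu.
Proof. exact: (@rpred0 _ (M_ mu)). Qed.

Lemma grD mu x (y : M) : x \in M_ mu -> y \in M_ mu -> x + y \in M_ mu.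
Proof. exact: (@rpredD _ (M_ mu)). Qed.

Lemma grZ mu (c : R) x : x \in M_ mu -> f c *: x \in M_ mu.
Proof. exact: (@rpredZ _ _ (M_ mu) c). Qed.

Lemma grN mu x : x \in M_ mu -> - x \in M_ mu.
Proof. by move=> xm; rewrite -scaleN1r -(rmorphN1 f) grZ. Qed.

Lemma grS (i : nat) mu s x : s \in S_ i -> x \in M_ mu -> s *: x \in M_ (i%:Z + mu).
Proof. exact: (gm_scale hM). Qed.

Definition decomposition x (s : seq int) (c : int -> M) : Prop :=
  [/\ uniq s, forall i, c i \in M_ i & x = \sum_(i <- s) c i].

Lemma decompositionE x : exists sc, decomposition x sc.1 sc.2.
Proof. by have [s [c d]] := (gm_sum hM).1 x; exists (s, c). Qed.

(** The projection onto degree mu, read off a chosen decomposition; by [pr_uniq]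
    any other decomposition gives the same value. *)
Definition pr mu x : M :=
  let sc := projT1 (cid (decompositionE x)) in
  if mu \in sc.1 then sc.2 mu else 0.

Lemma sum_extend (s u : seq int) (c : int -> M) : uniq s -> uniq u ->
  {subset s <= u} ->
  \sum_(i <- s) c i = \sum_(i <- u) (if i \in s then c i else 0).
Proof.
move=> us uu su; rewrite -big_mkcond -[RHS]big_filter /=.
apply: perm_big; apply: uniq_perm; rewrite ?filter_uniq// => i.
by rewrite mem_filter andb_idr// => /su.
Qed.

(** Two decompositions are compared on the union of their supports, where their
    difference is a decomposition of 0. *)
Lemma pr_uniq x s c : decomposition x s c ->
  forall mu, pr mu x = if mu \in s then c mu else 0.
Proof.
move=> [us cs ex] mu; rewrite /pr; case: (cid _) => -[s0 c0] [/= us0 cs0 ex0].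
pose e (s : seq int) (c : int -> M) i := if i \in s then c i else 0.
pose u := undup (s ++ s0).
have eu i : i \in u = (i \in s) || (i \in s0) by rewrite mem_undup mem_cat.
have em s' c' i : (forall i, c' i \in M_ i) -> e s' c' i \in M_ i.
  by move=> h; rewrite /e; case: ifP => _ //; exact: gr0.
have d0 : \sum_(i <- u) (e s c i - e s0 c0 i) = 0.
  rewrite sumrB -!sum_extend ?undup_uniq// -?ex -?ex0 ?subrr// => i si.
    by rewrite eu si orbT.
  by rewrite eu si.
have dz := (gm_sum hM).2 u _ (undup_uniq _) _ d0.
have [mu_u|] := boolP (mu \in u).
  apply/esym/eqP; rewrite -subr_eq0; apply/eqP; apply: dz => // i.
  by rewrite inE; apply: grD; [|apply: grN]; exact: em.
by rewrite eu negb_or => /andP[/negbTE-> /negbTE->].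
Qed.

Lemma pr_in mu x : pr mu x \in M_ mu.
Proof.
by rewrite /pr; case: (cid _) => -[s c] [/= _ cs _]; case: ifP => _ //; exact: gr0.
Qed.

Lemma pr_support x : exists s : seq int, forall u : seq int, uniq u -> {subset s <= u} ->
  decomposition x u (pr^~ x).
Proof.
have [[s c] [us cs ex]] := decompositionE x.
exists s => u uu su; split=> //; first by move=> i; exact: pr_in.
rewrite {1}ex (sum_extend _ us uu su); apply: eq_bigr => i _.
by rewrite (@pr_uniq x s c).
Qed.

Lemma pr_hom mu nu x : x \in M_ nu -> pr mu x = if mu == nu then x else 0.
Proof.
move=> xnu; rewrite (@pr_uniq x [:: nu] (fun i => if i == nu then x else 0)).
  by rewrite inE; case: eqP.
split=> // [i|]; last by rewrite big_seq1 eqxx.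
by case: eqP => [->//|_]; exact: gr0.
Qed.

Lemma pr_id mu x : x \in M_ mu -> pr mu x = x.
Proof. by move=> /pr_hom ->; rewrite eqxx. Qed.

Lemma prD mu x (y : M) : pr mu (x + y) = pr mu x + pr mu y.
Proof.
have [s hs] := pr_support x; have [s' hs'] := pr_support y.
pose u := undup (mu :: s ++ s').
have uu : uniq u := undup_uniq _.
have [|_ _ ex] := hs u uu.
  by move=> i si; rewrite mem_undup inE mem_cat si orbT.
have [|_ _ ey] := hs' u uu.
  by move=> i si; rewrite mem_undup inE mem_cat si !orbT.
rewrite (@pr_uniq _ u (fun i => pr i x + pr i y)).
  by rewrite mem_undup inE eqxx.
by split=> // [i|]; [apply: grD; exact: pr_in | rewrite big_split {1}ex {1}ey].
Qed.

Lemma prS (i : nat) mu s x : s \in S_ i -> pr (i%:Z + mu) (s *: x) = s *: pr mu x.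
Proof.
move=> si; have [t ht] := pr_support x; pose u := undup (mu :: t).
have [||uu _ ex] := ht u; first exact: undup_uniq.
  by move=> j tj; rewrite mem_undup inE tj orbT.
have eK (j : int) : i%:Z + j - i%:Z = j by rewrite addrAC subrr add0r.
rewrite (@pr_uniq _ [seq i%:Z + j | j <- u] (fun j => s *: pr (j - i%:Z) x)).
  by rewrite (mem_map (addrI _)) mem_undup inE eqxx eK.
split=> [|j|]; first by rewrite (map_inj_uniq (addrI _)).
  by have := grS si (pr_in (j - i%:Z) x); rewrite addrCA subrr addr0.
rewrite {1}ex scaler_sumr big_map; apply: eq_bigr => j _.
by rewrite eK.
Qed.

Lemma f_in c : f c \in S_ 0.
Proof. by apply/(sg_zero hS); exists c. Qed.

Lemma pr_f c mu x : pr mu (f c *: x) = f c *: pr mu x.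
Proof. by rewrite -(prS mu x (f_in c)) add0r. Qed.

Lemma pr_X i mu x : pr mu (X i *: x) = X i *: pr (mu - 1) x.
Proof. by rewrite -(prS _ x (sg_deg1 hS i)) addrC subrK. Qed.

Lemma pr_is_zmod mu : zmod_morphism (pr mu).
Proof.
move=> x y; rewrite prD -[- y]scaleN1r -(rmorphN1 f) pr_f rmorphN1.
by rewrite scaleN1r.
Qed.

HB.instance Definition _ mu := GRing.isZmodMorphism.Build M M (pr mu) (pr_is_zmod mu).

Lemma den_in (s : {set 'I_n}) : cech_den X s \in S_ #|s|.
Proof.
rewrite /cech_den -big_enum cardE.
elim: (enum _) => [|i l IHl]; rewrite ?big_nil ?big_cons /=.
  by rewrite -(rmorph1 f) f_in.
by rewrite -add1n; apply: (sg_mul hS) IHl; exact: (sg_deg1 hS).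
Qed.

Lemma exp_in (k m : nat) s : s \in S_ m -> s ^+ k \in S_ (k * m).
Proof.
move=> sm; elim: k => [|k IHk]; first by rewrite expr0 -(rmorph1 f) f_in.
by rewrite exprS mulSn; apply: (sg_mul hS).
Qed.

(** ** Homogeneous components of localizations *)

Section LocalizedProjection.
Variables (mu : int) (s : {set 'I_n}).
Local Notation loc := (localization M (cech_den X s)).

(** As X_s has degree #|s|, the part of degree mu of x / X_s ^+ k comes from the
    part of x of degree mu + k * #|s|. *)
Definition loc_pr (q : loc) : loc :=
  frac _ (pr (mu + ((repr q).2 * #|s|)%:Z) (repr q).1) (repr q).2.

Lemma loc_prE x k :
  loc_pr (frac _ x k) = frac _ (pr (mu + (k * #|s|)%:Z) x) k.
Proof.
have [l e] := repr_frac (cech_den X s) x k; apply/fracP; exists l.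
rewrite -!(prS _ _ (exp_in _ (den_in s))) -e; congr (pr _ _).
by rewrite !mulnDl !PoszD; lia.
Qed.

Lemma loc_pr_is_zmod : zmod_morphism loc_pr.
Proof.
move=> q1 q2; have [x [y [k [-> ->]]]] := frac_common q1 q2.
rewrite -[- frac _ y k]scaleN1r -[- loc_pr _]scaleN1r fracZ fracD !loc_prE.
by rewrite fracZ fracD !scaleN1r raddfB.
Qed.

HB.instance Definition _ := GRing.isZmodMorphism.Build loc loc loc_pr loc_pr_is_zmod.

Lemma loc_pr_sign k q : loc_pr ((-1) ^+ k *: q) = (-1) ^+ k *: loc_pr q.
Proof.
rewrite -signr_odd; case: (odd k); first by rewrite !expr1 !scaleN1r raddfN.
by rewrite expr0 !scale1r.
Qed.

Lemma loc_pr_fixed q : loc_pr q = q <->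
  exists (x : M) (k : nat), x \in M_ (mu + (k * #|s|)%:Z) /\ q = frac _ x k.
Proof.
split=> [<-|[x [k [xm ->]]]]; last by rewrite loc_prE pr_id.
by do 2!eexists; split; [|reflexivity]; exact: pr_in.
Qed.

End LocalizedProjection.

Lemma loc_pr_shift mu s i (q : localization M (cech_den X s)) :
  loc_pr mu (X i *: q) = X i *: loc_pr (mu - 1) q.
Proof.
have [x [k ->]] := fracE q.
by rewrite fracZ !loc_prE fracZ pr_X addrAC.
Qed.

Lemma cech_res_pr mu (t : {set 'I_n}) i (q : localization M (cech_den X (t :\ i))) :
  i \in t -> loc_pr mu (cech_res q) = cech_res (loc_pr mu q).
Proof.
move=> it; have [x [k ->]] := fracE q.
rewrite [X in _ = cech_res X]loc_prE !cech_resE// loc_prE; congr (frac _ _ _).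
rewrite -(prS _ _ (exp_in _ (sg_deg1 hS i))); congr (pr _ _).
by rewrite [in LHS](cardsD1 i t) it /= mulnDr PoszD; lia.
Qed.

Lemma cech_d_pr mu (c : cochain X M) t :
  cech_d (fun s => loc_pr mu (c s)) t = loc_pr mu (cech_d c t).
Proof.
rewrite raddf_sum; apply: eq_bigr => i it.
by rewrite /= loc_pr_sign cech_res_pr.
Qed.

Lemma homogeneousP mu (c : cochain X M) :
  homogeneous M_ mu c <-> forall s, loc_pr mu (c s) = c s.
Proof. by split=> h s; apply/loc_pr_fixed. Qed.

(** A primitive of a homogeneous cochain may be projected onto its degree, since
    the projection commutes with the differential. *)
Lemma homogeneous_coboundary mu p (c : cochain X M) :
  homogeneous M_ mu c -> coboundary p c ->
  exists b : cochain X M,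
    [/\ homogeneous M_ mu b, forall s : {set 'I_n}, #|s|.+1 != p -> b s = 0
      & forall t, c t = cech_d b t].
Proof.
move=> /homogeneousP hc [b [sb eb]]; exists (fun s => loc_pr mu (b s)); split.
- move=> s; have [x [k ->]] := fracE (b s); rewrite loc_prE.
  by do 2!eexists; split; [|reflexivity]; exact: pr_in.
- by move=> s /sb ->; rewrite raddf0.
- by move=> t; rewrite cech_d_pr -eb hc.
Qed.

(** * Generation in degrees at most the regularity *)

Section Chase.
Implicit Types (s t T : {set 'I_n}) (y z w : {set 'I_n} -> cochain X M).
Variable nu : int.
Hypothesis vanish : forall p : nat, gr_cohom_eq0 X M_ p (nu - p%:Z).

(** A family y is an element of the double complex: T indexes the Koszul direction
    and s the Cech direction. Only the Cech degree is recorded. *)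
Definition hom_supp (k : nat) (mu : int) (y : {set 'I_n} -> cochain X M) : Prop :=
  (forall T s, loc_pr mu (y T s) = y T s) /\
  (forall T s, #|s| != k -> y T s = 0).

Definition koszul (y : {set 'I_n} -> cochain X M) (T : {set 'I_n}) : cochain X M :=
  fun s => kos X (fun T' => y T' s) T.

Lemma cech_d_koszul y T t :
  cech_d (koszul y T) t = koszul (fun T' => cech_d (y T')) T t.
Proof. exact: cech_d_kos. Qed.

Lemma koszul_hom k mu y : hom_supp k mu y -> hom_supp k (mu + 1) (koszul y).
Proof.
move=> [hy sy]; split=> [T s|T s sk].
  rewrite /koszul /kos raddf_sum; apply: eq_bigr => i _.
  by rewrite /= -!scalerA loc_pr_sign loc_pr_shift addrK hy.
by rewrite /koszul /kos big1// => i _; rewrite sy// scaler0.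
Qed.

Lemma cech_d_hom k mu y : hom_supp k mu y ->
  hom_supp k.+1 mu (fun T => cech_d (y T)).
Proof.
move=> [hy sy]; split=> [T s|T s sk]; last exact: (cech_d_supp (sy T)).
by rewrite -cech_d_pr; apply: eq_cech_d => t; rewrite hy.
Qed.

(** Division by X_i on M_(X_s), for i in s: 1 / X_i is X_(s :\ i) / X_s. *)
Definition divX (s : {set 'I_n}) (i : 'I_n) (q : localization M (cech_den X s)) :=
  cech_den X (s :\ i) *: loc_div q.
Arguments divX : clear implicits.

Lemma divX_linear s i : linear (divX s i).
Proof. by move=> c q1 q2; rewrite /divX linearP scalerDr !scalerA (mulrC c). Qed.

Lemma divXK s i q : i \in s -> X i *: divX s i q = q.
Proof.
move=> si; rewrite /divX scalerA; have <- : cech_den X s = X i * cech_den X (s :\ i).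
  by rewrite /cech_den (big_setD1 i).
exact: loc_divK.
Qed.

Lemma divX_pr mu s i q : i \in s -> loc_pr mu q = q ->
  loc_pr (mu - 1) (divX s i q) = divX s i q.
Proof.
move=> si /loc_pr_fixed[x [k [xm ->]]]; apply/loc_pr_fixed.
exists (cech_den X (s :\ i) *: x), k.+1; rewrite /divX loc_divE fracZ; split=> //.
have := grS (den_in (s :\ i)) xm; rewrite (cardsD1 i s) si /=.
by congr (_ \in M_ _); rewrite !mulnDr; lia.
Qed.

(** The Koszul complex is exact on every localization M_(X_s) with s nonempty:
    contract along some i in s, which X_i being invertible there allows. *)
Lemma koszul_exact k mu y : hom_supp k.+1 mu y ->
  (forall T s, koszul y T s = 0) ->
  exists z, hom_supp k.+1 (mu - 1) z /\ forall T s, koszul z T s = y T s.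
Proof.
move=> [hy sy] dy.
pose z (T s : {set 'I_n}) := if [pick i in s] is Some i
  then contract i (divX s i) (fun T' => y T' s) T else 0.
exists z; split; first split=> T s; rewrite /z.
- case: pickP => [i si|_]; last exact: raddf0.
  rewrite /contract; case: ifP => _; last exact: raddf0.
  by rewrite loc_pr_sign divX_pr.
- move=> sk; case: pickP => [i si|//]; rewrite /contract.
  by rewrite sy// /divX !raddf0 if_same.
move=> T s; rewrite /koszul /z; case: pickP => [i si|s0].
  have [u eu] := linear_fun (@divX_linear s i).
  have Xu v : X i *: u v = v by rewrite eu divXK.
  rewrite -[RHS](kos_contract (fun T' => y T' s) T Xu).
  rewrite [X in _ + X]/contract; case: ifP => _; last first.
    by rewrite addr0; apply: eq_kos => T'; rewrite /contract eu.
  rewrite -/(koszul y _ s) dy raddf0 scaler0 addr0.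
  by apply: eq_kos => T'; rewrite /contract eu.
rewrite /kos big1 => [|i _]; last by rewrite scaler0.
by rewrite sy// (eq_card0 s0).
Qed.

(** With d the Cech and D the Koszul differential, and y such that D d y = 0, the
    claim is y = d w + D z. As D is exact on the positive Cech degrees, d y = D y'
    with y' again subject to the hypothesis, one step further in both directions.
    The induction gives y' = d z + D z', so that d y = D d z = d D z; now
    y - D z is a Cech cocycle of a degree in which the cohomology vanishes. The
    induction stops in Cech degree n, where d y = 0. *)
Lemma chase k y : hom_supp k (nu - k%:Z) y ->
  (forall T t, koszul (fun T' => cech_d (y T')) T t = 0) ->
  exists w z : {set 'I_n} -> cochain X M,
    [/\ forall T s, loc_pr (nu - k%:Z) (w T s) = w T s,
        forall T s, #|s|.+1 != k -> w T s = 0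
      & forall T s, y T s = cech_d (w T) s + koszul z T s].
Proof.
have [m mk] := ubnP (n.+1 - k)%N; elim: m k mk y => // m IHm k mk y hy dy.
have nuS : nu - k.+1%:Z = nu - k%:Z - 1 by lia.
suff [z hz ez] : exists2 z, hom_supp k (nu - k.+1%:Z) z &
    forall T t, cech_d (y T) t = cech_d (koszul z T) t.
  have hzy : hom_supp k (nu - k%:Z) (fun T s => y T s - koszul z T s).
    have [hk sk] := koszul_hom hz; rewrite nuS subrK in hk.
    split=> [T s|T s ks]; first by rewrite raddfB /= hk hy.1.
    by rewrite hy.2// sk// subrr.
  have /choice[w hw] T : exists b : cochain X M,
      [/\ homogeneous M_ (nu - k%:Z) b,
          forall s, #|s|.+1 != k -> b s = 0
        & forall t, y T t - koszul z T t = cech_d b t].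
    have hom : homogeneous M_ (nu - k%:Z) (fun s => y T s - koszul z T s).
      by apply/homogeneousP => s; exact: hzy.1.
    apply: homogeneous_coboundary => //; apply: vanish => //; split=> [s|t].
      exact: hzy.2.
    by rewrite cech_dB ez subrr.
  exists w, z; split=> [T|T|T s]; have [hom sw ew] := hw T => //.
    by apply/homogeneousP.
  by rewrite -ew subrK.
have [nk|kn] := ltnP n k.+1.
  exists (fun _ _ => 0); first by split=> *; rewrite ?raddf0.
  move=> T t; rewrite cech_d_koszul (cech_d_supp (hy.2 T)).
    by rewrite /koszul /kos big1// => i _; rewrite cech_d0 scaler0.
  by rewrite neq_ltn (leq_ltn_trans _ nk)// -[leqRHS]card_ord max_card.
have [y' [hy' ey']] := koszul_exact (cech_d_hom hy) dy.
rewrite -nuS in hy'.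
have [||w [z [hw sw ew]]] := IHm k.+1 _ y' hy'; first by lia.
  move=> T t; rewrite -cech_d_koszul (eq_cech_d (ey' T)) cech_dd//.
exists w; first by split=> // T s sk; rewrite sw// eqSS.
move=> T t; rewrite -ey' cech_d_koszul /koszul.
rewrite -[LHS]subr0 -(kos_kos X (fun T' => z T' t) T) -kosB.
by apply: eq_kos => T'; rewrite ew -/(koszul z T' t) addrK.
Qed.

(** Apply [chase] to x in bidegree (0, 0). There is no Cech cochain of degree -1,
    so x is a Koszul boundary, that is a combination of the X_i. *)
Lemma generated_below x : x \in M_ nu -> exists z : 'I_n -> M,
  (forall i, z i \in M_ (nu - 1)) /\ x = \sum_i X i *: z i.
Proof.
move=> xnu.
pose y (T s : {set 'I_n}) := if (T == finset.set0) && (s == finset.set0)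
  then frac (cech_den X s) x 0 else 0.
have hy : hom_supp 0 (nu - 0%:Z) y.
  split=> T s; rewrite /y.
    case: ifP => _; last exact: raddf0.
    by rewrite loc_prE [X in pr X _](_ : _ = nu) ?pr_id//; lia.
  by rewrite cards_eq0 => /negbTE->; rewrite andbF.
have yU i T : cech_d (y (i |: T)) = fun=> 0.
  apply: functional_extensionality_dep => t; rewrite -[RHS](cech_d0 X M t).
  apply: eq_cech_d => s; rewrite /y; case: eqP => // /setP /(_ i).
  by rewrite !inE eqxx.
have [T t|w [z [_ sw ew]]] := chase hy.
  by rewrite /koszul /kos big1// => i _; rewrite yU scaler0.
have := ew finset.set0 finset.set0; rewrite /y eqxx /=.
rewrite [cech_d _ _]big_set0 add0r /koszul /kos => ex.
pose z0 i := z (i |: finset.set0) finset.set0.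
have d1 : cech_den X finset.set0 = 1 by rewrite /cech_den big_set0.
have fr (q : localization M (cech_den X finset.set0)) :
    exists x', q = frac _ x' 0.
  have [x' [k ->]] := fracE q; exists x'; apply/fracP.
  by exists 0%N; rewrite d1 !expr1n.
have [u eu] := choice (fun i => fr (z0 i)).
exists (fun i => pr (nu - 1) (u i)); split=> [i|]; first exact: pr_in.
have fs (I : finType) (F : I -> M) :
    \sum_i frac (cech_den X finset.set0) (F i) 0 = frac _ (\sum_i F i) 0.
  by elim/big_rec2: _ => [|i v q _ ->]; rewrite ?fracD// frac0.
have : frac (cech_den X finset.set0) x 0 = frac _ (\sum_i X i *: u i) 0.
  rewrite ex -fs; apply: eq_big => i; first by rewrite !inE.
  move=> _; rewrite -[z _ _]/(z0 i) eu fracZ; congr (frac _ (_ *: _) _).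
  rewrite /pos_sign eq_card0 ?mul1r// => j.
  by rewrite !inE.
move/fracP => [l]; rewrite d1 !expr1n !scale1r => ex'.
rewrite -[LHS](pr_id xnu) ex' raddf_sum; apply: eq_bigr => i _.
by rewrite /= pr_X.
Qed.
End Chase.

(** * Finite generation of the components *)

Lemma standard_graded_decomposition (s : S) :
  exists c (y : 'I_n -> S), s = f c + \sum_i X i * y i.
Proof.
elim/(sg_gen hS): s => [c|i|_ _ [c [y ->]] [c' [y' ->]]|s s' [c [y es]] [c' [y' es']]].
- by exists c, (fun=> 0); rewrite big1 ?addr0// => i _; rewrite mulr0.
- exists 0, (fun j => (j == i)%:R); rewrite rmorph0 add0r (bigD1 i)//= eqxx mulr1.
  by rewrite big1 ?addr0// => j /negbTE->; rewrite mulr0.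
- exists (c + c'), (fun i => y i + y' i); rewrite rmorphD addrACA -big_split.
  by congr (_ + _); apply: eq_bigr => i _; rewrite mulrDr.
- exists (c * c'), (fun i => y i * s' + f c * y' i).
  rewrite {1}es mulrDl {1}es' mulrDr -rmorphM -addrA mulr_sumr mulr_suml -big_split.
  congr (_ + _); apply: eq_bigr => i _.
  by rewrite mulrDr addrC -mulrA (mulrCA (f c)).
Qed.

Lemma seq_lower_bound (s : seq int) : exists d : int, forall i, i \in s -> d <= i.
Proof.
elim: s => [|j s [d hd]]; first by exists 0.
exists (Num.min j d) => i; rewrite inE => /orP[/eqP->|/hd di].
  by rewrite ge_min lexx.
by rewrite ge_min di orbT.
Qed.

Lemma pr_eq0_low x : exists d : int, forall mu, mu < d -> pr mu x = 0.
Proof.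
have [[s c] h] := decompositionE x; have [d hd] := seq_lower_bound s.
by exists d => mu mud; rewrite (pr_uniq h); case: ifP => // /hd; rewrite leNgt mud.
Qed.

Section FinitelyGenerated.
Variables (k : nat) (g : 'I_k -> M).
Hypothesis gen : forall x, exists c : 'I_k -> S, x = \sum_i c i *: g i.

(** S has no elements of negative degree, so M starts no lower than the components
    of its generators. *)
Lemma graded_eq0_low : exists d : int, forall mu x, mu < d -> x \in M_ mu -> x = 0.
Proof.
have [d hd] := choice (fun j => pr_eq0_low (g j)).
have [d0 hd0] := seq_lower_bound [seq d j | j <- enum 'I_k].
pose low x := forall mu, mu < d0 -> pr mu x = 0.
have lowS s : forall x, low x -> low (s *: x).
  elim/(sg_gen hS): s => [c|i|s s' hs hs'|s s' hs hs'] x lx mu mud.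
  - by rewrite pr_f lx// scaler0.
  - by rewrite pr_X lx ?scaler0//; lia.
  - by rewrite scalerDl raddfD /= hs// hs'// addr0.
  - by rewrite -scalerA hs//; exact: hs'.
exists d0 => mu x mud /pr_id <-; have [c ->] := gen x.
rewrite raddf_sum big1// => j _; apply: lowS => // nu nud; apply: hd.
by apply: lt_le_trans nud _; apply: hd0; apply: map_f; rewrite mem_enum.
Qed.

Lemma graded_generators mu x : x \in M_ mu ->
  exists (c : 'I_k -> R) (z : 'I_n -> M), (forall i, z i \in M_ (mu - 1)) /\
    x = \sum_j f (c j) *: pr mu (g j) + \sum_i X i *: z i.
Proof.
move=> xmu; have [s es] := gen x.
have [c ec] := choice (fun j => standard_graded_decomposition (s j)).
have [y ey] := choice ec.
exists c, (fun i => pr (mu - 1) (\sum_j y j i *: g j)); split=> [i|].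
  exact: pr_in.
rewrite -[LHS](pr_id xmu) es.
under eq_bigr => j _ do rewrite ey scalerDl scaler_suml.
rewrite big_split raddfD /= raddf_sum; congr (_ + _).
  by apply: eq_bigr => j _; rewrite /= pr_f.
rewrite exchange_big /= raddf_sum; apply: eq_bigr => i _.
rewrite /= -pr_X scaler_sumr; congr (pr _ _); apply: eq_bigr => j _.
by rewrite scalerA.
Qed.

(** By induction on mu, starting below all nonzero components: M_mu is generated by
    the components of degree mu of the generators and by the products of the X_i
    with generators of M_(mu-1). *)
Lemma graded_component_span mu : exists (I : finType) (e : I -> M),
  (forall i, e i \in M_ mu) /\
  forall x, x \in M_ mu -> exists c : I -> R, x = \sum_i f (c i) *: e i.
Proof.
have [d hd] := graded_eq0_low.
have [m mm] : exists m : nat, mu < d + m%:Z by exists `|mu - d|.+1; lia.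
elim: m mu mm => [|m IHm] mu mm.
  exists void, (of_void M); split=> [[]|x xmu].
  exists (fun=> 0); by rewrite (hd _ _ _ xmu) ?big1//; lia.
have [|I [e [he sp]]] := IHm (mu - 1); first by lia.
exists ('I_k + 'I_n * I)%type.
exists (fun u => match u with inl j => pr mu (g j) | inr v => X v.1 *: e v.2 end).
split=> [[j|[i j]]|x /graded_generators[c [z [hz ->]]]] /=.
- exact: pr_in.
- have := grS (sg_deg1 hS i) (he j); by rewrite addrC subrK.
have [c' ec'] := choice (fun i => sp _ (hz i)).
exists (fun u => match u with inl j => c j | inr v => c' v.1 v.2 end).
rewrite big_sumType /=; congr (_ + _).
rewrite -(pair_bigA _ (fun i j => f (c' i j) *: (X i *: e j))) /=.
apply: eq_bigr => i _; rewrite {1}ec' scaler_sumr; apply: eq_bigr => j _.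
by rewrite !scalerA mulrC.
Qed.

Lemma graded_component_fg mu : finitely_generated (submodule (M_ mu)).
Proof.
have [I [e [he sp]]] := graded_component_span mu.
have [h eh] := linear_fun (@submodule_val_linear _ _ (M_ mu)).
exists #|I|, (fun i => Submodule (he (enum_val i))) => x.
have [c ec] := sp _ (valP x); exists (fun i => c (enum_val i)).
apply: val_inj; rewrite -[RHS]eh raddf_sum [LHS]ec.
rewrite (reindex _ (onW_bij _ (enum_val_bij I))).
by apply: eq_bigr => i _; rewrite /= linearZ eh.
Qed.

End FinitelyGenerated.

(** * Annihilators of consecutive components *)

(** Such an x vanishes in every M_(X_i), so that it is a Cech 0-cocycle, and the only
    0-coboundary is 0. *)
Lemma socle_eq0 mu x : gr_cohom_eq0 X M_ 0 mu -> x \in M_ mu ->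
  (forall i, X i *: x = 0) -> x = 0.
Proof.
move=> H0 xmu Xx.
pose c : cochain X M := fun s => if s == finset.set0 then frac _ x 0 else 0.
have [||b [sb eb]] := H0 c.
- move=> s; rewrite /c; case: ifP => _; last by exists 0, 0%N; rewrite frac0 gr0.
  by exists x, 0%N; rewrite mul0n addr0.
- split=> [s|t]; first by rewrite /c cards_eq0 => /negbTE->.
  apply: big1 => i it; have [h eh] := cech_res_lin X M it.
  rewrite /c; case: eqP => [e|_]; last by rewrite eh raddf0 scaler0.
  rewrite cech_resE// expr0 scale1r; have -> : frac (cech_den X t) x 0 = 0.
    apply/frac_eq0; exists 1%N; rewrite expr1 /cech_den (big_setD1 i)//= mulrC.
    by rewrite -scalerA Xx scaler0.
  exact: scaler0.
have := eb finset.set0; rewrite /c eqxx [cech_d _ _]big_set0 => /frac_eq0[l].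
by rewrite /cech_den big_set0 expr1n scale1r.
Qed.

Lemma ann_below mu : gr_cohom_eq0 X M_ 0 mu ->
  kills (ann (submodule (M_ (mu + 1)))) (submodule (M_ mu)).
Proof.
move=> H0 c ac x; apply: val_inj; apply: (@socle_eq0 mu) => // [|i].
  exact: (valP (c *: x)).
have Xx : X i *: (val x : M) \in M_ (mu + 1).
  by rewrite addrC; exact: grS (sg_deg1 hS i) (valP x).
have /(congr1 val) e := ac (Submodule Xx).
by rewrite -[val (c *: x)]/(f c *: (val x : M)) scalerA mulrC -scalerA.
Qed.

Lemma ann_above nu : (forall p : nat, gr_cohom_eq0 X M_ p (nu - p%:Z)) ->
  kills (ann (submodule (M_ (nu - 1)))) (submodule (M_ nu)).
Proof.
move=> H c ac x; apply: val_inj.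
have [z [hz ex]] := generated_below H (valP x).
transitivity (f c *: (val x : M)) => //; rewrite ex scaler_sumr big1// => i _.
rewrite scalerA mulrC -scalerA.
have /(congr1 val) /= e := ac (Submodule (hz i)).
by rewrite [f c *: _]e scaler0.
Qed.

End Grading.

(** * The bounds on the degree *)

Lemma esup_ge (E : set (\bar int)) x : E x -> (x <= esup E)%E.
Proof. by case: (esupP E) => ub _; exact: ub. Qed.

Lemma esup_le (E : set (\bar int)) x : (forall y, E y -> (y <= x)%E) -> (esup E <= x)%E.
Proof. by case: (esupP E) => _ lub h; exact: lub. Qed.

Section Invariants.
Variables (R S : comPzRingType) (f : {rmorphism R -> S}) (n : nat) (X : 'I_n -> S).
Variables (M : lmodType S) (M_ : int -> submodClosed (res_scalars f M)).

Lemma a_inv_lt i (mu : int) : (a_inv X M_ i < mu%:E)%E -> gr_cohom_eq0 X M_ i mu.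
Proof.
move=> lt; apply: contrapT => H; move: lt; rewrite ltNge => /negP[].
by apply: esup_ge; exists mu.
Qed.

Lemma reg_lt (nu : int) (p : nat) :
  (reg X M_ < nu%:E)%E -> gr_cohom_eq0 X M_ p (nu - p%:Z).
Proof.
move=> lt; apply: contrapT => H; move: lt; rewrite ltNge => /negP[].
by apply: esup_ge; exists nu => //; exists p.
Qed.

Lemma depth_gt (i : nat) : (i%:Z%:E < depth X M)%E -> cohom_eq0 X M i.
Proof.
move=> lt; apply: contrapT => H; move: lt; rewrite ltNge => /negP[].
apply: esup_le => p [_ hp]; rewrite leNgt; apply/negP => /hp.
exact: H.
Qed.

Lemma depth_ge0 : (0%:E <= depth X M)%E.
Proof.
by apply: esup_ge; split=> // i; rewrite lte_fin ltz_nat.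
Qed.

Lemma a_inv0_le_reg : (a_inv X M_ 0 <= reg X M_)%E.
Proof.
apply: esup_le => _ [mu H <-]; apply: esup_ge; exists mu => //.
by exists 0%N; rewrite subr0.
Qed.

Lemma a_inv0_depth : (0%:E < depth X M)%E -> a_inv X M_ 0 = -oo%E.
Proof.
move=> /(@depth_gt 0) H; apply/eqP; rewrite -leeNy_eq; apply: esup_le => _ [mu nH <-].
by case: nH => c _; exact: H.
Qed.

Lemma reg_depth : (n%:Z%:E < depth X M)%E -> reg X M_ = -oo%E.
Proof.
move=> lt; apply/eqP; rewrite -leeNy_eq; apply: esup_le => _ [mu [p H] <-].
case: H => c _; have [/cohom_eq0_gt|pn] := ltnP n p; first by apply.
by apply: depth_gt; apply: le_lt_trans lt; rewrite lee_fin lez_nat.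
Qed.

(** If the depth exceeds n, all cohomology vanishes and the regularity is -oo.
    Otherwise n - depth is nonnegative; it is zero only for a depth n > 0, and
    then a^0 is -oo. *)
Lemma regularity_bound (mu : int) : (0 < n)%N ->
  (reg X M_ + n%:Z%:E - depth X M <= mu%:E)%E ->
  (reg X M_ <= mu%:E)%E /\ (a_inv X M_ 0 < mu%:E)%E.
Proof.
move=> n0; have [dn|nd] := leP (depth X M) n%:Z%:E; last first.
  have rN := reg_depth nd; move=> _; rewrite rN leNye; split=> //.
  by apply: le_lt_trans a_inv0_le_reg _; rewrite rN ltNyr.
have a_le := a_inv0_le_reg; have a_d := a_inv0_depth; have := depth_ge0.
case: (depth X M) dn a_d => [d| |]; rewrite ?leye_eq ?leeNy_eq//= lee_fin => dn a_d.
rewrite lee_fin => d0.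
have [d_pos|d_le0] := ltP 0 d.
  rewrite a_d ?lte_fin// ltNyr.
  case: (reg X M_) => [e| |]//= h; split=> //; move: h; rewrite !lee_fin; lia.
case: (reg X M_) a_le => [e| |]//= a_le h; split=> //.
- by move: h; rewrite !lee_fin; lia.
- by apply: le_lt_trans a_le _; move: h; rewrite !(lee_fin, lte_fin); lia.
- exact: le_lt_trans a_le (ltNyr _).
Qed.

End Invariants.

Theorem proposition4p9
    (R S : comPzRingType) (f : {rmorphism R -> S})
    (S_ : nat -> zmodClosed S) (n : nat) (X : 'I_n -> S)
    (hS : standard_graded f S_ X)
    (M : lmodType S) (M_ : int -> submodClosed (res_scalars f M))
    (hM : graded_module S_ M_) (hfg : finitely_generated M)
    (r : nat) (a : 'I_r -> R) :
  (forall mu nu : int, (a_inv X M_ 0 < mu%:E)%E -> mu <= nu ->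
     (cd a (submodule (M_ mu)) <= cd a (submodule (M_ nu)))%E)
  /\
  ((0 < n)%N -> forall mu nu : int,
     (reg X M_ + n%:Z%:E - depth X M <= mu%:E)%E ->
     (reg X M_ + n%:Z%:E - depth X M <= nu%:E)%E ->
     cd a (submodule (M_ mu)) = cd a (submodule (M_ nu))).
Proof.
have [k [g gen]] := hfg.
have fg mu : finitely_generated (submodule (M_ mu)) := graded_component_fg hS hM gen mu.
have step (P : int -> int -> Prop) (mu nu : int) : mu <= nu ->
    (forall l, P l l) -> (forall l, mu <= l -> P mu l -> P mu (l + 1)) -> P mu nu.
  move=> le P0 PS; have -> : nu = mu + `|nu - mu|%N%:Z by lia.
  elim: `|nu - mu|%N => [|m IHm]; first by rewrite addr0.
  by rewrite -addn1 PoszD addrA; apply: PS; rewrite ?lerDl.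
have mono (mu nu : int) : (a_inv X M_ 0 < mu%:E)%E -> mu <= nu ->
    (cd a (submodule (M_ mu)) <= cd a (submodule (M_ nu)))%E.
  move=> amu le; apply: (step (fun i j => (cd a (submodule (M_ i)) <=
    cd a (submodule (M_ j)))%E)) => // l mul /le_trans; apply.
  apply: cd_le_annihilator => //; apply: (ann_below hS hM).
  by apply: a_inv_lt; apply: lt_le_trans amu _; rewrite lee_fin.
split=> // n0.
have eqcd (mu nu : int) : (reg X M_ + n%:Z%:E - depth X M <= mu%:E)%E ->
    mu <= nu -> cd a (submodule (M_ mu)) = cd a (submodule (M_ nu)).
  move=> /(regularity_bound n0)[rmu amu] le.
  apply/eqP; rewrite eq_le mono//=.
  apply: (step (fun i j => (cd a (submodule (M_ j)) <=
    cd a (submodule (M_ i)))%E)) => // l mul; apply: le_trans.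
  apply: cd_le_annihilator => //.
  rewrite -[l in ann (submodule (M_ l))](addrK 1); apply: (ann_above hS hM) => p.
  by apply: reg_lt; apply: le_lt_trans rmu _; rewrite lte_fin; lia.
move=> mu nu bmu bnu; have [le|/ltW le] := leP mu nu; first exact: eqcd.
by apply/esym; exact: eqcd.
Qed.
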